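(* Fix integers $a$, $b$, and $m$ with $1 \leq a < b \leq m$. Then, as $n \to \infty$, \[\log e(P_n^{m,a,b}) = (m-b+a-1)\,n\log n + c(m,a,b)\,n + O_{m,a,b}(\log n),\] where \begin{align*} c(m, a, b) =&~(b - a)\log \mathrm{B} \left(\frac{a - 1}{b - a}+1, \frac{m - b}{b - a}+1\right) - \log \mathrm{B} (a, m-b+1) \\ &- \log\Gamma(m - b + a + 1) + (m - 1)\log (m - 1) - (b - a)\log(b - a) - m + b - a + 1. \end{align*}
   Context: For a finite poset $P$, $e(P)$ denotes the number of linear extensions of $P$. For integers $1 \le a < b \le m$ and $n \ge 1$, the cluster poset $P_n^{m,a,b}$ is obtained by gluing together $n$ chains of length $m$: its elements are $A_{i,j}$ for $1 \le i \le n$ and $1 \le j \le m$, where $A_{i,b} = A_{i+1,a}$ for $1 \le i \le n-1$ and the $A_{i,j}$ are distinct otherwise (so there are $(m-1)n+1$ elements in total); its relations are generated by $A_{i,1} \le A_{i,2} \le \cdots \le A_{i,m}$ for $1 \le i \le n$. $\mathrm{B}$ is the beta function, $\mathrm{B}(\alpha,\beta) = \int_0^1 u^{\alpha-1}(1-u)^{\beta-1}\,du = \frac{\Gamma(\alpha)\Gamma(\beta)}{\Gamma(\alpha+\beta)}$, and $\Gamma$ is the gamma function. $\log$ is the natural logarithm. The implied constant in $O_{m,a,b}(\cdot)$ may depend on $m,a,b$ but not on $n$. *)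

(* Defs.v *)
From HB Require Import structures.
From mathcomp Require Import all_boot all_order all_algebra generic_quotient.
From mathcomp Require Import all_classical all_reals all_analysis.
From mathcomp Require Import zify.
Import Order.TTheory GRing.Theory Num.Theory.
Import numFieldNormedType.Exports.

Set Implicit Arguments.
Unset Strict Implicit.
Unset Printing Implicit Defensive.

(* A linear extension is encoded as an order-preserving bijection onto the
   chain 'I_#|P|; injectivity is enough since the cardinals agree. *)
Definition linear_extensions (d : Order.disp_t) (P : finPOrderType d) :
    {set {ffun P -> 'I_#|P|}} :=
  [set f : {ffun P -> 'I_#|P|} | injectiveb f &&
     [forall x, forall y, (x <= y)%O ==> (f x <= f y)%N]].

Definition num_linear_extensions (d : Order.disp_t) (P : finPOrderType d) :
    nat := #|linear_extensions P|.

Section ClusterPoset.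
Local Open Scope quotient_scope.
Variables (m a b n : nat) (hab : 1 <= a < b).

(* The pair (i, j) : 'I_n * 'I_m, with 0-based indices, stands for the j-th
   element of the i-th chain: (i, j) is A_{i+1,j+1}. *)
Definition glued (p q : 'I_n * 'I_m) : bool :=
  [&& p.2.+1 == b, q.2.+1 == a & q.1 == p.1.+1 :> nat].

Definition glue_rel (p q : 'I_n * 'I_m) : bool :=
  [|| p == q, glued p q | glued q p].

Lemma glue_rel_refl : reflexive glue_rel.
Proof. by move=> p; rewrite /glue_rel eqxx. Qed.

Lemma glue_rel_sym : symmetric glue_rel.
Proof. by move=> p q; rewrite /glue_rel eq_sym [glued p q || _]orbC. Qed.

Lemma glue_rel_trans : transitive glue_rel.
Proof.
move=> q p r; rewrite /glue_rel /glued.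
case: p q r => [[p1 ?] [p2 ?]] [[q1 ?] [q2 ?]] [[r1 ?] [r2 ?]].
rewrite -!pair_eqE /pair_eq -!val_eqE /=; lia.
Qed.

Definition glue_equiv :=
  EquivRel glue_rel glue_rel_refl glue_rel_sym glue_rel_trans.

Definition cluster_type := {eq_quot glue_equiv}.
HB.instance Definition _ := Quotient.on cluster_type.
HB.instance Definition _ := EqQuotient.on cluster_type.
HB.instance Definition _ :=
  Finite.copy cluster_type (can_type (@EquivQuot.ereprK _ _ _ _ glue_equiv _)).

Definition cluster_elt (i : 'I_n) (j : 'I_m) : cluster_type :=
  \pi_cluster_type (i, j).

Lemma cluster_eltE i j i' j' :
  (cluster_elt i j == cluster_elt i' j') = glue_rel (i, j) (i', j').
Proof. exact: eqmodE. Qed.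

Lemma cluster_eltP (x : cluster_type) : exists i j, x = cluster_elt i j.
Proof.
by exists (repr x).1, (repr x).2; rewrite /cluster_elt -surjective_pairing reprK.
Qed.

Definition cluster_cover (x y : cluster_type) : bool :=
  [exists i : 'I_n, exists j : 'I_m, exists k : 'I_m,
    [&& k == j.+1 :> nat, x == cluster_elt i j & y == cluster_elt i k]].

Definition cluster_le (x y : cluster_type) : bool := connect cluster_cover x y.

Definition cluster_height (x : cluster_type) : nat :=
  (repr x).1 * (b - a) + (repr x).2.

Lemma cluster_height_elt i j :
  cluster_height (cluster_elt i j) = i * (b - a) + j.
Proof.
rewrite /cluster_height.
case e: (repr (cluster_elt i j)) => [i' j'] /=.
have : cluster_elt i' j' == cluster_elt i j by rewrite /cluster_elt -e reprK.
rewrite cluster_eltE /glue_rel /glued /=.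
case/or3P => [/eqP[-> ->] //||] /and3P[/eqP e1 /eqP e2 /eqP e3];
  rewrite e3 mulSn; lia.
Qed.

Lemma cluster_cover_height x y : cluster_cover x y ->
  cluster_height y = (cluster_height x).+1.
Proof.
move=> /existsP[i] /existsP[j] /existsP[k] /and3P[/eqP e /eqP-> /eqP->].
by rewrite !cluster_height_elt e addnS.
Qed.

Lemma cluster_le_height x y : cluster_le x y ->
  x = y \/ cluster_height x < cluster_height y.
Proof.
move=> /connectP[p]; elim: p x => [|z p IH] x /=; first by left.
move=> /andP[/cluster_cover_height hz pz] yE; right.
by have [<-|] := IH _ pz yE; rewrite hz // => /ltnW.
Qed.

Lemma cluster_le_refl : reflexive cluster_le.
Proof. exact: connect0. Qed.

Lemma cluster_le_anti : antisymmetric cluster_le.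
Proof.
move=> x y /andP[/cluster_le_height[//|xy] /cluster_le_height[//|]].
by rewrite ltnNge ltnW.
Qed.

Lemma cluster_le_trans : transitive cluster_le.
Proof. exact: connect_trans. Qed.

Fact cluster_display : Order.disp_t. Proof. exact: Order.Disp tt tt. Qed.

HB.instance Definition _ := Order.Le_isPOrder.Build cluster_display cluster_type
  cluster_le_refl cluster_le_anti cluster_le_trans.

Definition cluster_poset : finPOrderType cluster_display := cluster_type.

End ClusterPoset.

Arguments cluster_poset m a b n hab : clear implicits.

Section EulerIntegrals.
Variable R : realType.
Local Open Scope ring_scope.

(* The library's [beta_fun] only takes natural-number arguments. *)
Definition Beta (x y : R) : R :=
  \int[lebesgue_measure]_(u in `[0, 1]%classic)
    (u `^ (x - 1) * (1 - u) `^ (y - 1)).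

Definition Gamma (x : R) : R :=
  \int[lebesgue_measure]_(t in `]0, +oo[%classic)
    (t `^ (x - 1) * expR (- t)).

Definition cluster_const (m a b : nat) : R :=
  let m' := m%:R in let a' := a%:R in let b' := b%:R in
  (b' - a') * ln (Beta ((a' - 1) / (b' - a') + 1) ((m' - b') / (b' - a') + 1))
  - ln (Beta a' (m' - b' + 1))
  - ln (Gamma (m' - b' + a' + 1))
  + (m' - 1) * ln (m' - 1)
  - (b' - a') * ln (b' - a')
  - m' + b' - a' + 1.

End EulerIntegrals.

(* Main.v *)
Require Import Defs.
From mathcomp Require Import all_boot all_order all_algebra.
From mathcomp Require Import all_classical all_reals all_analysis.
From mathcomp Require Import measurable_realfun zify ring lra.
Import Order.TTheory GRing.Theory Num.Theory.
Import numFieldNormedType.Exports.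
Set Implicit Arguments.
Unset Strict Implicit.
Unset Printing Implicit Defensive.
Local Open Scope ring_scope.

(** Write p = a - 1, d = b - a, q = m - b. The gluing makes one chain (the
    spine) of n d + 1 elements; its elements number 0, d, ..., (n - 1) d carry a
    chain of p elements hanging below, and those number d, 2 d, ..., n d a chain
    of q elements hanging above.

    Throwing independent uniform points of [0, 1] on the elements, e(P) / |P|! is
    the probability that they respect the order. Integrating out the hanging
    chains gives the integral of
      prod_(i < n) x_(i d)^p / p! * prod_(0 < i <= n) (1 - x_(i d))^q / q!
    over the increasing spines x_0 < ... < x_(n d). Since the x_k increase,
    x_(i d)^p is at most prod_(i d <= k < (i + 1) d) x_k^(p / d), and shifting the
    blocks by one reverses the inequality up to boundary terms; the same holds
    for 1 - x. Up to factors polynomial in n, the integrand is thus the symmetric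
    function prod_k w(x_k), w(x) = x^(p / d) (1 - x)^(q / d), whose integral over
    increasing sequences is B^(n d) / (n d)! with B = Beta (p / d + 1, q / d + 1).
    Hence
      e(P) = |P|! (p! q!)^(-n) B^(n d) / (n d)! n^O(1)
    and Stirling's formula concludes, since the integer values of the Beta and
    Gamma functions in the constant multiply to p! q!.

    The multiple integral is replaced by counting. The injective monotone maps
    from P to t + 1 labels number e(P) 'C(t + 1, |P|)
    ([card_injective_monotone_maps]). They are among the strictly monotone maps,
    and weakly monotone maps exceed them by a negligible number as t grows. Both
    kinds of maps are counted exactly by iterated sums along the spine
    ([card_cover_preserving]), one for each relation, < or <=, on labels. The
    spreading of weights ([spread_weights_le], [spread_weights_ge]) and the
    discrete form of the integral of s^k ds ([strict_integration],
    [weak_integration]) bound these sums by powers of the sum of w over the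
    grid, a Riemann sum of B with error O(1) ([Riemann_sum_le],
    [Riemann_sum_ge]). Letting t tend to infinity for fixed n gives
    [linear_extensions_le] and [linear_extensions_ge], whose logarithms are
    compared in [ln_linear_extensions_approx]. *)

(** * Linear extensions and injective monotone maps *)

Section LinearExtensions.
Context (d : Order.disp_t) (P : finPOrderType d) (k : nat).

Definition injective_monotone_maps : {set {ffun P -> 'I_k.+1}} :=
  [set g : {ffun P -> 'I_k.+1} | injectiveb g &&
     [forall x, forall y, (x <= y)%O ==> (g x <= g y)%N]].

Lemma enum_set_ord_sorted (S : {set 'I_k.+1}) :
  sorted (fun i j : 'I_k.+1 => i < j)%N (enum S).
Proof.
rewrite -(@sorted_map _ _ val ltn).
have: sorted ltn [seq val i | i <- enum 'I_k.+1].
  by rewrite val_enum_ord iota_ltn_sorted.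
rewrite !sorted_map; apply: subseq_sorted; first by move=> ? ? ?; apply: ltn_trans.
exact: (@filter_subseq _ (mem S)).
Qed.

(** An injective monotone map is a linear extension followed by the increasing
    enumeration of its image, an arbitrary set of |P| labels. *)
Lemma card_injective_monotone_maps :
  #|injective_monotone_maps| = (num_linear_extensions P * 'C(k.+1, #|P|))%N.
Proof.
pose K : {set {set 'I_k.+1}} := [set S : {set 'I_k.+1} | #|S| == #|P|].
have cK : #|K| = 'C(k.+1, #|P|).
  rewrite -[in RHS](card_ord k.+1) -[in RHS]cardsT -cards_draws.
  by apply: eq_card => S; rewrite !inE finset.subsetT.
rewrite -cK /num_linear_extensions -cardsX.
have trl : transitive (fun i j : 'I_k.+1 => i < j)%N by move=> ? ? ?; apply: ltn_trans.
have nth_lt (S : {set 'I_k.+1}) i j : (i < #|S|)%N -> (j < #|S|)%N ->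
    (i < j)%N -> (nth ord0 (enum S) i < nth ord0 (enum S) j)%N.
  move=> iS jS; apply: (sorted_ltn_nth trl _ (enum_set_ord_sorted S)).
    by rewrite inE -cardE.
  by rewrite inE -cardE.
have nth_le (S : {set 'I_k.+1}) i j : (i < #|S|)%N -> (j < #|S|)%N ->
    (i <= j)%N -> (nth ord0 (enum S) i <= nth ord0 (enum S) j)%N.
  by move=> iS jS; rewrite leq_eqVlt => /predU1P[->//|ij]; rewrite ltnW ?nth_lt.
have idx_le (S : {set 'I_k.+1}) u v : u \in S -> v \in S -> (u <= v)%N ->
    (index u (enum S) <= index v (enum S))%N.
  rewrite -[u \in S]mem_enum -[v \in S]mem_enum => uS vS uv.
  rewrite leqNgt; apply/negP => vu.
  have := nth_lt S _ _ _ _ vu; rewrite !nth_index// cardE !index_mem => /(_ vS uS).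
  by rewrite ltnNge uv.
apply/eqP; rewrite eqn_leq; apply/andP; split.
(* A map is determined by its image and by the ranks of its values in it. *)
- have P0 (x : P) : (0 < #|P|)%N by apply/card_gt0P; exists x.
  pose to (g : {ffun P -> 'I_k.+1}) :=
    let S := [set g x | x in P] in
    ([ffun x => insubd (Ordinal (P0 x)) (index (g x) (enum S))]
       : {ffun P -> 'I_#|P|}, S).
  have toE g x : g \in injective_monotone_maps ->
      (to g).1 x = index (g x) (enum (to g).2) :> nat.
    rewrite inE => /andP[/injectiveP gi _]; rewrite ffunE val_insubd.
    have: g x \in enum [set g x | x in P] by rewrite mem_enum imset_f.
    by rewrite -index_mem -cardE card_imset// => ->.
  have to_inj : {in injective_monotone_maps &, injective to}.
    move=> g h gm hm e; apply/ffunP => x.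
    have := toE h x hm; rewrite -e (toE _ _ gm) => /(congr1 (nth ord0 (enum (to g).2))).
    rewrite !nth_index//; first by rewrite mem_enum e imset_f.
    by rewrite mem_enum imset_f.
  rewrite -(card_in_imset to_inj); apply: subset_leq_card.
  apply/fintype.subsetP => _ /imsetP[g gm ->]; rewrite inE /= !inE.
  have gi : injective g by move: gm; rewrite inE => /andP[/injectiveP].
  have gS x : g x \in (to g).2 by rewrite imset_f.
  rewrite card_imset// eqxx andbT; apply/andP; split.
    apply/injectiveP => x y /(congr1 val) /=; rewrite !toE// => e; apply: gi.
    rewrite -[g x](@nth_index _ ord0 _ (enum (to g).2)) ?mem_enum//.
    by rewrite e nth_index// mem_enum.
  apply/forallP => x; apply/forallP => y; apply/implyP => xy.
  rewrite !toE// idx_le//.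
  by move: gm; rewrite inE => /andP[_ /forallP/(_ x)/forallP/(_ y)/implyP]; apply.
(* The pair is recovered from the map, whose image is the set of labels. *)
- pose from (fS : {ffun P -> 'I_#|P|} * {set 'I_k.+1}) : {ffun P -> 'I_k.+1} :=
    [ffun x => nth ord0 (enum fS.2) (fS.1 x)].
  have from_im (f : {ffun P -> _}) (S : {set 'I_k.+1}) : injective f -> #|S| = #|P| ->
      [set from (f, S) x | x in P] = S.
    move=> fi cS; have fiS : injective (from (f, S)).
      move=> x y; rewrite !ffunE/= => /eqP.
      rewrite nth_uniq ?enum_uniq -?cardE ?cS ?ltn_ord// => /eqP/val_inj.
      exact: fi.
    apply/eqP; rewrite eqEcard card_imset// cS leqnn andbT.
    apply/fintype.subsetP => _ /imsetP[x _ ->]; rewrite ffunE/= -mem_enum mem_nth//.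
    by rewrite -cardE cS.
  have from_inj : {in finset.setX (linear_extensions P) K &, injective from}.
    move=> [f S] [f' S']; rewrite !inE/=.
    move=> /andP[/andP[/injectiveP fi _] /eqP cS].
    move=> /andP[/andP[/injectiveP fi' _] /eqP cS'] e.
    have eS : S = S' by rewrite -[LHS](from_im f S fi cS) e from_im.
    subst S'; congr pair; apply/ffunP => x.
    move/ffunP: e => /(_ x) /eqP; rewrite !ffunE/=.
    by rewrite nth_uniq ?enum_uniq -?cardE ?cS ?ltn_ord// => /eqP/val_inj.
  rewrite -(card_in_imset from_inj); apply: subset_leq_card.
  apply/fintype.subsetP => _ /imsetP[[f S] fS ->]; move: fS; rewrite !inE/=.
  move=> /andP[/andP[/injectiveP fi /forallP fm] /eqP cS]; apply/andP; split.
    apply/injectiveP => x y; rewrite !ffunE/= => /eqP.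
    rewrite nth_uniq ?enum_uniq -?cardE ?cS ?ltn_ord// => /eqP/val_inj.
    exact: fi.
  apply/forallP => x; apply/forallP => y; apply/implyP => xy.
  rewrite !ffunE/= nth_le ?cS//.
  by move: (fm x) => /forallP/(_ y)/implyP; apply.
Qed.

(** The excess on the right counts all maps that are not injective; it is of
    lower order in k than k ^ |P|. *)
Lemma card_monotone_maps_le :
  (#|[set g : {ffun P -> 'I_k.+1} |
        [forall x, forall y, (x <= y)%O ==> (g x <= g y)%N]]|
   <= num_linear_extensions P * 'C(k.+1, #|P|)
      + (k.+1 ^ #|P| - k.+1 ^_ #|P|))%N.
Proof.
rewrite -card_injective_monotone_maps.
set M := [set _ | _].
have cI : #|[set g : {ffun P -> 'I_k.+1} | injectiveb g]| = (k.+1 ^_ #|P|)%N.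
  have := card_inj_ffuns P 'I_k.+1; rewrite card_ord => <-.
  by apply: eq_card => g; rewrite inE.
have cT : #|[set: {ffun P -> 'I_k.+1}]| = (k.+1 ^ #|P|)%N.
  by rewrite cardsT card_ffun card_ord.
rewrite -cI -cT -cardsDS ?finset.subsetT//.
apply: leq_trans (leq_card_setU _ _); apply: subset_leq_card.
by apply/fintype.subsetP => g; rewrite !inE => ->; rewrite andbT; case: injectiveb.
Qed.

End LinearExtensions.

(** * Labellings of the cluster poset as spines with hanging chains *)

Section PathSums.
Context (R : comNzRingType) (L : finType) (e : rel L).

(** The transfer operator of the relation: when [e] is an order on labels, it is
    the discrete analogue of integrating [phi] over the points above [u]. *)
Definition succ_sum (e : rel L) (phi : L -> R) (u : L) : R :=
  \sum_(v | e u v) phi v.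

Lemma sum_tupleS (T : finType) k (F : k.+1.-tuple T -> R) :
  \sum_t F t = \sum_x \sum_(s : k.-tuple T) F [tuple of x :: s].
Proof.
rewrite pair_bigA /= (reindex (fun xs : T * k.-tuple T => [tuple of xs.1 :: xs.2]))//=.
exists (fun t => (thead t, [tuple of behead t])) => [[x s]|t] _ /=.
  by rewrite theadE; congr pair; apply: val_inj.
by rewrite -tuple_eta.
Qed.

Lemma sum_paths (f : rel L) k (phi : L -> R) u :
  \sum_(s : k.-tuple L) (path f u s)%:R * phi (last u s)
  = iter k (succ_sum f) phi u.
Proof.
elim: k u => [|k IH] u.
  rewrite (big_pred1 [tuple]) ?mul1r//= => s; exact/esym/eqP/tuple0.
rewrite sum_tupleS /= /succ_sum [RHS]big_mkcond/=; apply: eq_bigr => x _.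
case: (f u x) => /=; last by rewrite big1// => s _; rewrite mul0r.
by rewrite -IH.
Qed.

Section Blocks.
Variables (p d q : nat).

(** The labels that one row of the cluster poset adds once the label of its
    [a]-th element is known: first the elements below it, listed downwards, then
    the spine up to the [b]-th element, then the elements above that one. *)
Definition block : Type := p.-tuple L * d.-tuple L * q.-tuple L.

Definition block_ok (u : L) (B : block) : bool :=
  [&& path (fun x y => e y x) u B.1.1, path e u B.1.2
    & path e (last u B.1.2) B.2].

Fixpoint blocks_ok (u : L) (s : seq block) : bool :=
  if s is B :: s' then block_ok u B && blocks_ok (last u B.1.2) s' else true.

(** The number of ways to label [n] rows compatibly with [e] when the
    spine starts at label [u]: the factors count the chain hanging below [u],
    the [d] steps along the spine, the chain hanging above the point reached, and
    the remaining rows. *)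
Fixpoint caterpillar_sum (n : nat) (u : L) : R :=
  if n is n'.+1 then
    iter p (succ_sum (fun x y => e y x)) (fun=> 1) u
    * iter d (succ_sum e)
        (fun v => iter q (succ_sum e) (fun=> 1) v * caterpillar_sum n' v) u
  else 1.

Lemma sum_blocks n u :
  \sum_(s : n.-tuple block) (blocks_ok u s)%:R = caterpillar_sum n u.
Proof.
elim: n u => [|n IH] u.
  rewrite (big_pred1 [tuple])//= => s; exact/esym/eqP/tuple0.
rewrite sum_tupleS /= -!sum_paths.
under eq_bigr => B _.
  under eq_bigr => s _ do rewrite -mulnb natrM.
  rewrite -mulr_sumr IH /block_ok -!mulnb !natrM; over.
rewrite -(pair_bigA _ (fun (cx : p.-tuple L * d.-tuple L) (y : q.-tuple L) =>
  (path (fun x y => e y x) u cx.1)%:R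
  * ((path e u cx.2)%:R * (path e (last u cx.2) y)%:R) *
  caterpillar_sum n (last u cx.2)))/=.
rewrite -(pair_bigA _ (fun (c : p.-tuple L) (x : d.-tuple L) => \sum_(y : q.-tuple L)
  (path (fun x y => e y x) u c)%:R
  * ((path e u x)%:R * (path e (last u x) y)%:R) *
  caterpillar_sum n (last u x)))/=.
rewrite mulr_suml; apply: eq_bigr => c _; rewrite mulr1.
rewrite mulr_sumr; apply: eq_bigr => x _.
rewrite -sum_paths mulr_suml !mulr_sumr; apply: eq_bigr => y _.
by rewrite mulr1; ring.
Qed.

End Blocks.
End PathSums.

Section ClusterEncoding.
Context (L : finType) (p d q n : nat) (hab : (0 < p.+1 < (p + d).+1)%N).

Local Notation P := (cluster_type (p + d + q).+1 n.+1 hab).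

Definition entry (g : {ffun P -> L}) (i j : nat) : L :=
  g (cluster_elt hab (inord i) (inord j)).

Lemma entry_glue g i : (i < n)%N -> entry g i (p + d) = entry g i.+1 p.
Proof.
move=> ilt; rewrite /entry; congr (g _); apply/eqP.
rewrite cluster_eltE /glue_rel /glued /= !inordK ?eqxx ?orbT//; lia.
Qed.

Lemma entry_inj g h :
  (forall i j, (i <= n)%N -> (j <= p + d + q)%N -> entry g i j = entry h i j) ->
  g = h.
Proof.
move=> gh; apply/ffunP => x; have [i [j ->]] := cluster_eltP x.
have := gh i j (ltn_ord i) (ltn_ord j).
by rewrite /entry !inord_val.
Qed.

(** Listing the lower chain downwards makes every chain of a block start next to
    a spine vertex, so that all order conditions become [path] conditions. *)
Definition encode (g : {ffun P -> L}) : L * n.+1.-tuple (block L p d q) :=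
  (entry g 0 p,
   [tuple ([tuple entry g i (p - k.+1) | k < p],
           [tuple entry g i (p + k.+1) | k < d],
           [tuple entry g i (p + d + k.+1) | k < q]) | i < n.+1]).

Definition spine_vertex (u : L) (s : seq (block L p d q)) (i : nat) : L :=
  foldl (fun v B => last v (tval B.1.2)) u (take i s).

Definition decode_entry (us : L * n.+1.-tuple (block L p d q)) (i j : nat) : L :=
  let u := us.1 in
  let B := nth ([tuple u | _ < p], [tuple u | _ < d], [tuple u | _ < q]) us.2 i in
  if (j < p)%N then nth u B.1.1 (p - j.+1)
  else if (j <= p + d)%N then nth u (spine_vertex u us.2 i :: B.1.2) (j - p)
  else nth u B.2 (j - (p + d).+1).

Definition decode us : {ffun P -> L} :=
  [ffun x : P => decode_entry us (repr x).1 (repr x).2].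

(** This identity is what makes [decode] well defined on the glued elements. *)
Lemma decode_entry_glue us i : (i < n)%N ->
  decode_entry us i (p + d) = decode_entry us i.+1 p.
Proof.
case: us => u s ilt; rewrite /decode_entry /= ltnn leqnn leq_addr.
rewrite ltnNge leq_addr /= subnn addKn /= /spine_vertex.
rewrite (take_nth ([tuple u | _ < p], [tuple u | _ < d], [tuple u | _ < q])); last first.
  by rewrite size_tuple ltnW.
rewrite -cats1 foldl_cat /=; set B := nth _ _ _; set v := foldl _ _ _.
rewrite (last_nth u) size_tuple.
by apply: set_nth_default; rewrite /= size_tuple.
Qed.

Lemma entry_decode us i j : (i <= n)%N -> (j <= p + d + q)%N ->
  entry (decode us) i j = decode_entry us i j.
Proof.
move=> ilt jlt; rewrite /entry ffunE.
set x := cluster_elt _ _ _.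
have : cluster_elt hab (repr x).1 (repr x).2 == cluster_elt hab (inord i) (inord j).
  by rewrite /cluster_elt -surjective_pairing reprK.
case: (repr x) => i' j' /=; rewrite cluster_eltE /glue_rel /glued /=.
have iE : (inord i : 'I_n.+1) = i :> nat by rewrite inordK.
have jE : (inord j : 'I_(p + d + q).+1) = j :> nat by rewrite inordK.
case/or3P => [/eqP[-> ->]|/and3P[/eqP e1 /eqP e2 /eqP e3]|/and3P[/eqP e1 /eqP e2 /eqP e3]].
- by rewrite iE jE.
- have -> : i = i'.+1 by rewrite -iE.
  have -> : j = p by lia.
  have -> : (j' : nat) = (p + d)%N by lia.
  by rewrite decode_entry_glue//; lia.
- have -> : (i' : nat) = i.+1 by lia.
  have -> : (j' : nat) = p by lia.
  have -> : j = (p + d)%N by lia.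
  by rewrite -decode_entry_glue//; have := ltn_ord i'; lia.
Qed.

Lemma encodeK : cancel decode encode.
Proof.
move=> us; have dec := entry_decode us.
rewrite /encode dec//; last by lia.
case: us dec => u s dec; congr pair.
  by rewrite /decode_entry /= ltnn leq_addr subnn /spine_vertex take0.
apply: eq_from_tnth => i; rewrite tnth_mktuple.
have dE := fun j => dec i j (ltn_ord i).
rewrite /decode_entry/= in dE.
have sB : nth ([tuple u | _ < p], [tuple u | _ < d], [tuple u | _ < q]) s i
  = tnth s i by rewrite -tnth_nth.
rewrite sB in dE; case: (tnth s i) dE => [[c x] y] /= dE {sB}.
congr (_, _, _); apply: eq_from_tnth => k; rewrite tnth_mktuple dE; have := ltn_ord k => kk.
- have -> : (p - k.+1 < p)%N by lia.
  by rewrite (tnth_nth u); congr (nth u c _); lia.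
- by lia.
- have -> : (p + k.+1 < p)%N = false by lia.
  have -> : (p + k.+1 <= p + d)%N by lia.
  by rewrite addKn /= (tnth_nth u).
- by lia.
- have -> : (p + d + k.+1 < p)%N = false by lia.
  have -> : (p + d + k.+1 <= p + d)%N = false by lia.
  by rewrite (tnth_nth u); congr (nth u y _); lia.
- by lia.
Qed.

Lemma encode_inj : injective encode.
Proof.
move=> g h e; have e0 : entry g 0 p = entry h 0 p by move: e => [].
have eB i (iln : (i < n.+1)%N) : tnth (encode g).2 (Ordinal iln)
   = tnth (encode h).2 (Ordinal iln) by rewrite e.
apply: entry_inj => i j iln jlt.
have [jp|] := ltnP j p.
  have kp : (p - j.+1 < p)%N by lia.
  have := congr1 (fun B : block L p d q => tnth B.1.1 (Ordinal kp)) (eB i iln).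
  by rewrite !tnth_mktuple /= (_ : p - (p - j.+1).+1 = j)%N//; lia.
have spine i' j' : (i' <= n)%N -> (p < j' <= p + d)%N ->
    entry g i' j' = entry h i' j'.
  move=> iln' /andP[pj jpd].
  have kd : (j' - p.+1 < d)%N by lia.
  have := congr1 (fun B : block L p d q => tnth B.1.2 (Ordinal kd)) (eB i' iln').
  by rewrite !tnth_mktuple /= (_ : p + (j' - p.+1).+1 = j')%N//; lia.
rewrite leq_eqVlt => /predU1P[<-|pj].
  case: i iln => [//|i] iln; rewrite -!entry_glue//; apply: spine; lia.
have [jpd|pdj] := leqP j (p + d); first by apply: spine; lia.
have kq : (j - (p + d).+1 < q)%N by lia.
have := congr1 (fun B : block L p d q => tnth B.2 (Ordinal kq)) (eB i iln).
by rewrite !tnth_mktuple /= (_ : p + d + (j - (p + d).+1).+1 = j)%N//; lia.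
Qed.

Definition cover_preserving (e : rel L) : {set {ffun P -> L}} :=
  [set g : {ffun P -> L} |
     [forall x : P, forall y : P, cluster_cover x y ==> e (g x) (g y)]].

Lemma cover_preservingP (e : rel L) g : reflect
  (forall i j, (i <= n)%N -> (j < p + d + q)%N -> e (entry g i j) (entry g i j.+1))
  (g \in cover_preserving e).
Proof.
rewrite inE; apply: (iffP idP) => [/forallP gP i j iln jlt|gP].
  move: (gP (cluster_elt hab (inord i) (inord j))) => /forallP.
  move=> /(_ (cluster_elt hab (inord i) (inord j.+1)))/implyP; apply.
  apply/existsP; exists (inord i); apply/existsP; exists (inord j).
  by apply/existsP; exists (inord j.+1); rewrite !eqxx !inordK ?eqxx//; lia.
apply/forallP => x; apply/forallP => y; apply/implyP.
move=> /existsP[i /existsP[j /existsP[k /and3P[/eqP kE /eqP-> /eqP->]]]].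
have := gP i j; rewrite /entry -kE !inord_val; apply.
  exact: ltn_ord i.
exact: ltn_ord k.
Qed.

(** Offsets [s] are kept general for the sake of the induction. *)
Lemma path_mkseq (f : rel L) (F : nat -> L) s r :
  path f (F s) [seq F k.+1 | k <- iota s r]
  = all (fun k => f (F k) (F k.+1)) (iota s r).
Proof. by elim: r s => //= r IH s; rewrite IH. Qed.

Lemma last_mkseq (F : nat -> L) s r :
  last (F s) [seq F k.+1 | k <- iota s r] = F (s + r)%N.
Proof. by elim: r s => [|r IH] s /=; rewrite ?addn0// IH addSnnS. Qed.

Lemma val_mktuple (T : Type) (F : nat -> T) r :
  tval [tuple F k | k < r] = [seq F k | k <- iota 0 r].
Proof. by rewrite /= -val_enum_ord -map_comp. Qed.

Lemma blocks_ok_encode e g :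
  blocks_ok e (encode g).1 (encode g).2 = (g \in cover_preserving e).
Proof.
rewrite (val_mktuple (fun i => ([tuple entry g i (p - k.+1) | k < p],
           [tuple entry g i (p + k.+1) | k < d],
           [tuple entry g i (p + d + k.+1) | k < q]))).
pose row_ok i := all (fun j => e (entry g i j) (entry g i j.+1)) (iota 0 (p + d + q)).
suff okE s r : (s + r <= n.+1)%N ->
    blocks_ok e (entry g s p) [seq ([tuple entry g i (p - k.+1) | k < p],
           [tuple entry g i (p + k.+1) | k < d],
           [tuple entry g i (p + d + k.+1) | k < q]) | i <- iota s r]
    = all row_ok (iota s r).
  rewrite (okE 0%N n.+1)//; apply/allP/cover_preservingP => [gP i j iln jlt|gP i].
    have iI : i \in iota 0 n.+1 by rewrite mem_iota.
    by move/allP: (gP i iI) => /(_ j); rewrite mem_iota; apply.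
  rewrite mem_iota leq0n add0n => iln; apply/allP => j; rewrite mem_iota => jlt.
  exact: gP.
elim: r s => // r IH s srn.
cbn [iota map blocks_ok all]; rewrite /block_ok; cbn [fst snd].
rewrite !(val_mktuple (fun k => entry g s (p - k.+1))).
rewrite !(val_mktuple (fun k => entry g s (p + k.+1))).
rewrite !(val_mktuple (fun k => entry g s (p + d + k.+1))).
have := last_mkseq (fun k => entry g s (p + k)) 0 d; rewrite addn0 add0n => ->.
have := path_mkseq e (fun k => entry g s (p + k)) 0 d; rewrite addn0 => ->.
have := path_mkseq e (fun k => entry g s (p + d + k)) 0 q; rewrite addn0 => ->.
have := path_mkseq (fun x y => e y x) (fun k => entry g s (p - k)) 0 p; rewrite subn0 => ->.
congr andb; last first.
  case: r IH srn => // r IH srn; rewrite entry_glue ?IH//; lia.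
apply/and3P/allP => [[/allP c /allP x /allP y] j|gP].
  rewrite mem_iota add0n => /andP[_ jlt].
  have [jp|pj] := ltnP j p.
    have := c (p - j.+1)%N; rewrite mem_iota.
    have -> : (p - (p - j.+1).+1 = j)%N by lia.
    have -> : (p - (p - j.+1) = j.+1)%N by lia.
    by apply; lia.
  have [jpd|pdj] := ltnP j (p + d).
    have := x (j - p)%N; rewrite mem_iota addnS subnKC//; apply; lia.
  have := y (j - (p + d))%N; rewrite mem_iota addnS subnKC//; apply; lia.
split; apply/allP => k; rewrite mem_iota add0n => /andP[_ kl].
- have := gP (p - k.+1)%N; rewrite mem_iota.
  have -> : ((p - k.+1).+1 = p - k)%N by lia.
  by apply; lia.
- have := gP (p + k)%N; rewrite mem_iota -addnS; apply; lia.
- have := gP (p + d + k)%N; rewrite mem_iota -addnS; apply; lia.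
Qed.

(** The Hasse diagram of the cluster poset is a tree, so labellings that respect
    its edges are counted by the transfer operator. The relation is left
    arbitrary: < and <= give the two bounds on linear extensions, and the full
    relation gives the cardinal of the poset. *)
Lemma card_cover_preserving (R : comNzRingType) (e : rel L) :
  #|cover_preserving e|%:R
  = \sum_u caterpillar_sum R e p d q n.+1 u :> R.
Proof.
under eq_bigr => u _ do rewrite -sum_blocks.
rewrite pair_bigA /=.
have enc_bij : {on predT, bijective encode}.
  exists decode => us _; [apply: encode_inj|]; exact: encodeK.
rewrite (reindex _ enc_bij)/=.
under eq_bigr => g _ do rewrite blocks_ok_encode.
rewrite -sum1_card natr_sum big_mkcond/=; apply: eq_bigr => g _.
by case: ifP.
Qed.
End ClusterEncoding.

(** * Counting monotone labellings *)

 
Section ClusterCounts.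
Context (p d q n : nat) (hab : (0 < p.+1 < (p + d).+1)%N).

Local Notation P := (cluster_poset (p + d + q).+1 p.+1 (p + d).+1 n.+1 hab).

Lemma iter_succ_sum_total (R : comNzRingType) (L : finType) k (c : R) (u : L) :
  iter k (succ_sum (fun _ _ => true)) (fun=> c) u = c * #|L|%:R ^+ k.
Proof.
elim: k u => [|k IH] u; first by rewrite expr0 mulr1.
rewrite iterS {1}/succ_sum; under eq_bigr => v _ do rewrite IH.
by rewrite sumr_const exprSr mulrA mulr_natr.
Qed.

(** Counting all maps to a set with two elements determines the exponent. *)
Lemma card_cluster_poset : #|P| = (n.+1 * (p + d + q)).+1.
Proof.
have := card_cover_preserving q n hab int (fun _ _ : bool => true).
have -> : cover_preserving q n hab (fun _ _ : bool => true) = [set: _].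
  by apply/setP => g; rewrite !inE; apply/forallP => x; apply/forallP => y; apply/implyP.
rewrite cardsT card_ffun card_bool.
have catE (u : bool) k : caterpillar_sum int (fun _ _ => true) p d q k u
    = 2%:R ^+ (k * (p + d + q)).
  elim: k u => [|k IH] u; first by rewrite expr0.
  rewrite /= iter_succ_sum_total.
  have -> : (fun v : bool => iter q (succ_sum (fun _ _ => true)) (fun=> 1) v *
     caterpillar_sum int (fun _ _ => true) p d q k v)
     = (fun=> 2%:R ^+ (q + k * (p + d + q))).
    by apply/funext => v; rewrite IH iter_succ_sum_total card_bool mul1r exprD.
  rewrite iter_succ_sum_total card_bool mul1r -!exprD; congr (_ ^+ _); lia.
under eq_bigr => u _ do rewrite catE.
rewrite sumr_const card_bool -[X in _ = X]mulr_natl -exprS -!natrX => /eqP.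
by rewrite eqr_nat => /eqP/expnI; apply.
Qed.

Lemma linear_extensions_le_strict (R : realType) t :
  (num_linear_extensions P * 'C(t.+1, #|P|))%:R
  <= \sum_u caterpillar_sum R (fun i j : 'I_t.+1 => (i < j)%N) p d q n.+1 u.
Proof.
rewrite -(card_cover_preserving q n hab) ler_nat -card_injective_monotone_maps.
apply: subset_leq_card; apply/fintype.subsetP => g.
rewrite !inE => /andP[/injectiveP gi /forallP gm].
apply/forallP => x; apply/forallP => y; apply/implyP => xy.
rewrite ltn_neqAle; apply/andP; split.
  apply/eqP => /val_inj/gi e; have := cluster_cover_height xy.
  by rewrite e => /n_Sn.
by move/forallP: (gm x) => /(_ y)/implyP; apply; exact: connect1.
Qed.

Lemma weak_le_linear_extensions (R : realType) t :
  \sum_u caterpillar_sum R (fun i j : 'I_t.+1 => (i <= j)%N) p d q n.+1 u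
  <= (num_linear_extensions P * 'C(t.+1, #|P|)
      + (t.+1 ^ #|P| - t.+1 ^_ #|P|))%:R.
Proof.
rewrite -(card_cover_preserving q n hab) ler_nat.
apply: leq_trans (card_monotone_maps_le _ _).
apply: subset_leq_card; apply/fintype.subsetP => g.
rewrite !inE => /forallP gm.
apply/forallP => x; apply/forallP => y; apply/implyP => /connectP[s].
elim: s x => [|z s IH] x /=; first by move=> _ ->.
move=> /andP[xz zs] ys; apply: (@leq_trans (g z)); last exact: IH.
by move/forallP: (gm x) => /(_ z)/implyP; apply.
Qed.
End ClusterCounts.

(** * Iterated sums along a chain *)

Section Telescoping.
Context (R : realFieldType).

Lemma exprD_ge_linear (x y : R) k : 0 <= x -> 0 <= y ->
  x ^+ k.+1 + k.+1%:R * (y * x ^+ k) <= (x + y) ^+ k.+1.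
Proof.
move=> x0 y0; elim: k => [|k IH]; first by rewrite !expr1 expr0 mulr1 mul1r.
rewrite [leRHS]exprS; apply: le_trans (ler_wpM2l (addr_ge0 x0 y0) IH).
have y2 : 0 <= k.+1%:R * (y * (y * x ^+ k)) by rewrite !mulr_ge0 ?exprn_ge0.
rewrite -subr_ge0; apply: le_trans y2 _.
by rewrite -[k.+2%:R]natr1 !exprS le_eqVlt; apply/orP; left; apply/eqP; ring.
Qed.

Lemma exprD_le_linear (x y : R) k : 0 <= x -> 0 <= y ->
  (x + y) ^+ k.+1 <= x ^+ k.+1 + k.+1%:R * (y * (x + y) ^+ k).
Proof.
move=> x0 y0; elim: k => [|k IH]; first by rewrite !expr1 expr0 mulr1 mul1r.
rewrite [leLHS]exprS; apply: le_trans (ler_wpM2l (addr_ge0 x0 y0) IH) _.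
have y2 : 0 <= y * ((x + y) ^+ k.+1 - x ^+ k.+1).
  by rewrite mulr_ge0// subr_ge0 lerXn2r ?nnegrE ?addr_ge0// lerDl.
rewrite -subr_ge0; apply: le_trans y2 _.
by rewrite -[k.+2%:R]natr1 !exprS le_eqVlt; apply/orP; left; apply/eqP; ring.
Qed.

Lemma sum_prefix_powers_le (F : nat -> R) k r : (forall i, 0 <= F i) ->
  k.+1%:R * (\sum_(0 <= i < r) F i * (\sum_(0 <= j < i) F j) ^+ k)
  <= (\sum_(0 <= i < r) F i) ^+ k.+1.
Proof.
move=> F0; elim: r => [|r IH]; first by rewrite !big_nil mulr0 exprS mul0r.
rewrite !big_nat_recr//= mulrDr.
apply: le_trans (exprD_ge_linear _ _ (F0 r)); last exact: sumr_ge0.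
by rewrite lerD2r.
Qed.

Lemma sum_prefix_powers_ge (F : nat -> R) k r : (forall i, 0 <= F i) ->
  (\sum_(0 <= i < r) F i) ^+ k.+1
  <= k.+1%:R * (\sum_(0 <= i < r) F i * (\sum_(0 <= j < i.+1) F j) ^+ k).
Proof.
move=> F0; elim: r => [|r IH]; first by rewrite !big_nil mulr0 exprS mul0r.
rewrite !big_nat_recr//=.
apply: le_trans (exprD_le_linear _ _ (F0 r)) _; first exact: sumr_ge0.
by rewrite [leRHS]mulrDr lerD2r.
Qed.

(** The discrete form of the inequality, in one direction, between
    (k + 1) times the integral of F S^k and S^(k + 1), where S is the primitive
    of F; strict order relations give sums below the integral, reflexive ones
    sums above it. *)
Definition strict_integration (L : finType) (e : rel L) : Prop :=
  forall (F : L -> R) u k, (forall v, 0 <= F v) ->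
  k.+1%:R * succ_sum e (fun v => F v * succ_sum e F v ^+ k) u
  <= succ_sum e F u ^+ k.+1.

Definition weak_integration (L : finType) (e : rel L) : Prop :=
  forall (F : L -> R) u k, (forall v, 0 <= F v) ->
  succ_sum e F u ^+ k.+1
  <= k.+1%:R * succ_sum e (fun v => F v * succ_sum e F v ^+ k) u.

Section Ordinals.
Variable t : nat.

Lemma sum_ord_lt (F : 'I_t.+1 -> R) r : (r <= t.+1)%N ->
  \sum_(v : 'I_t.+1 | (v < r)%N) F v = \sum_(0 <= i < r) F (inord i).
Proof.
move=> rt; rewrite big_mkord (big_ord_widen _ (fun i => F (inord i)) rt).
by apply: eq_bigr => i _; rewrite inord_val.
Qed.

(** Reversal of labels transports each statement on < to one on >. *)
Lemma sum_ord_gt (F : 'I_t.+1 -> R) (u : 'I_t.+1) :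
  \sum_(v : 'I_t.+1 | (u < v)%N) F v
  = \sum_(v : 'I_t.+1 | (v < rev_ord u)%N) F (rev_ord v).
Proof.
rewrite (reindex_inj rev_ord_inj)/=; apply: eq_bigl => v.
have := ltn_ord u; have := ltn_ord v; lia.
Qed.

Lemma sum_ord_ge (F : 'I_t.+1 -> R) (u : 'I_t.+1) :
  \sum_(v : 'I_t.+1 | (u <= v)%N) F v
  = \sum_(v : 'I_t.+1 | (v <= rev_ord u)%N) F (rev_ord v).
Proof.
rewrite (reindex_inj rev_ord_inj)/=; apply: eq_bigl => v.
have := ltn_ord u; have := ltn_ord v; lia.
Qed.

Lemma strict_integration_gt :
  strict_integration (fun i j : 'I_t.+1 => (j < i)%N).
Proof.
move=> F u k F0; rewrite /succ_sum !sum_ord_lt ?(ltnW (ltn_ord u))//.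
apply: le_trans (sum_prefix_powers_le k u (fun i => F0 (inord i))).
rewrite ler_pM2l ?ltr0n// le_eqVlt; apply/orP; left; apply/eqP.
apply: eq_big_nat => i /andP[_ iu]; have it := ltn_trans iu (ltn_ord u).
by rewrite sum_ord_lt inordK// ltnW.
Qed.

Lemma weak_integration_ge :
  weak_integration (fun i j : 'I_t.+1 => (j <= i)%N).
Proof.
move=> F u k F0; rewrite /succ_sum.
have sumE (G : 'I_t.+1 -> R) (v : 'I_t.+1) : \sum_(w : 'I_t.+1 | (w <= v)%N) G w
    = \sum_(0 <= i < v.+1) G (inord i).
  by rewrite -sum_ord_lt.
rewrite !sumE.
apply: le_trans (sum_prefix_powers_ge k u.+1 (fun i => F0 (inord i))) _.
rewrite ler_pM2l ?ltr0n// le_eqVlt; apply/orP; left; apply/eqP.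
apply: eq_big_nat => i /andP[_ iu]; rewrite sumE inordK//.
by rewrite (leq_trans iu).
Qed.

Lemma strict_integration_lt :
  strict_integration (fun i j : 'I_t.+1 => (i < j)%N).
Proof.
move=> F u k F0; have := strict_integration_gt (rev_ord u) k (fun v => F0 (rev_ord v)).
rewrite /succ_sum !sum_ord_gt; under [X in _ -> _ * X <= _]eq_bigr do rewrite sum_ord_gt rev_ordK.
exact.
Qed.

Lemma weak_integration_le :
  weak_integration (fun i j : 'I_t.+1 => (i <= j)%N).
Proof.
move=> F u k F0; have := weak_integration_ge (rev_ord u) k (fun v => F0 (rev_ord v)).
rewrite /succ_sum !sum_ord_ge; under [X in _ -> _ <= _ * X]eq_bigr do rewrite sum_ord_ge rev_ordK.
exact.
Qed.

End Ordinals.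

Section Iterated.
Context (L : finType) (e : rel L).
Implicit Types (phi F : L -> R).

Lemma succ_sum_ge0 phi u : (forall v, 0 <= phi v) -> 0 <= succ_sum e phi u.
Proof. by move=> phi0; apply: sumr_ge0. Qed.

Lemma iter_succ_sum_ge0 k phi u : (forall v, 0 <= phi v) ->
  0 <= iter k (succ_sum e) phi u.
Proof. by move=> phi0; elim: k u => //= k IH u; apply: succ_sum_ge0. Qed.

Lemma iter_succ_sum1_le k u : strict_integration e ->
  iter k (succ_sum e) (fun=> 1 : R) u <= succ_sum e (fun=> 1 : R) u ^+ k / k`!%:R.
Proof.
move=> eI; elim: k u => [|k IH] u; first by rewrite expr0 divr1.
rewrite iterS ler_pdivlMr ?ltr0n ?fact_gt0//.
apply: le_trans (eI (fun=> 1) u k (fun=> ler01)).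
rewrite /succ_sum mulr_suml mulr_sumr; apply: ler_sum => v _.
by rewrite mul1r factS natrM mulrCA ler_wpM2l// -ler_pdivlMr ?ltr0n ?fact_gt0.
Qed.

Lemma iter_succ_sum1_ge k u : weak_integration e ->
  succ_sum e (fun=> 1 : R) u ^+ k / k`!%:R <= iter k (succ_sum e) (fun=> 1 : R) u.
Proof.
move=> eI; elim: k u => [|k IH] u; first by rewrite expr0 divr1.
rewrite iterS ler_pdivrMr ?ltr0n ?fact_gt0//.
apply: le_trans (eI (fun=> 1) u k (fun=> ler01)) _.
rewrite /succ_sum mulr_suml mulr_sumr; apply: ler_sum => v _.
rewrite mul1r factS natrM mulrCA ler_wpM2l// -ler_pdivrMr ?ltr0n ?fact_gt0//.
exact: IH.
Qed.

(** One spine step with weight [al] on the departure and [be] on the arrival. *)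
Definition weighted_sum (al be phi : L -> R) (u : L) : R :=
  al u * succ_sum e (fun v => be v * phi v) u.

Lemma iter_weighted_sum_ge0 al be k phi u :
  (forall v, 0 <= al v) -> (forall v, 0 <= be v) -> (forall v, 0 <= phi v) ->
  0 <= iter k (weighted_sum al be) phi u.
Proof.
move=> al0 be0 phi0; elim: k u => //= k IH u.
by rewrite mulr_ge0// succ_sum_ge0// => v; rewrite mulr_ge0.
Qed.

Section Spreading.
Variables (al be : L -> R).
Hypotheses (al0 : forall v, 0 <= al v) (be0 : forall v, 0 <= be v).
Hypothesis al_nd : forall u v, e u v -> al u <= al v.
Hypothesis be_ni : forall u v, e u v -> be v <= be u.

Lemma iter_succ_sum_pull k phi u : (forall v, 0 <= phi v) ->
  iter k (succ_sum e) (fun v => be v * phi v) u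
  <= be u * iter k (succ_sum e) phi u.
Proof.
move=> phi0; elim: k u => //= k IH u; rewrite /succ_sum mulr_sumr.
apply: ler_sum => v uv; apply: le_trans (IH v) _.
by rewrite ler_wpM2r ?iter_succ_sum_ge0// be_ni.
Qed.

Lemma iter_succ_sum_push k phi u : (forall v, 0 <= phi v) ->
  al u * iter k (succ_sum e) phi u
  <= iter k (succ_sum e) (fun v => al v * phi v) u.
Proof.
move=> phi0; elim: k u => //= k IH u; rewrite /succ_sum mulr_sumr.
apply: ler_sum => v uv; apply: le_trans (IH v).
by rewrite ler_wpM2r ?iter_succ_sum_ge0// al_nd.
Qed.

(** Along a path the nondecreasing weight [al] is smallest at the start and the
    nonincreasing weight [be] is smallest at the end, so [al ^+ k] taken at the
    start and [be ^+ k] taken at the end may be distributed one by one over the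
    [k] steps. *)
Lemma spread_weights_le k phi u : (forall v, 0 <= phi v) ->
  al u ^+ k * iter k (succ_sum e) (fun v => be v ^+ k * phi v) u
  <= iter k (weighted_sum al be) phi u.
Proof.
move=> phi0; elim: k u => [|k IH] u; first by rewrite /= !expr0 !mul1r.
rewrite exprS -mulrA !iterS /weighted_sum ler_wpM2l//.
rewrite /succ_sum mulr_sumr; apply: ler_sum => v uv.
apply: le_trans (ler_wpM2l (be0 v) (IH v)).
rewrite mulrCA; apply: ler_pM; rewrite ?exprn_ge0 ?iter_succ_sum_ge0//.
- by move=> w; rewrite mulr_ge0 ?exprn_ge0.
- by rewrite lerXn2r ?nnegrE// al_nd.
under [X in iter _ _ X]funext do rewrite exprS -mulrA.
by apply: iter_succ_sum_pull => w; rewrite mulr_ge0 ?exprn_ge0.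
Qed.

(** Here [al ^+ k] is taken at the end of the path and [be ^+ k] at its start,
    where these weights are largest. *)
Lemma spread_weights_ge k phi u : (forall v, 0 <= phi v) ->
  iter k (weighted_sum be al) phi u
  <= be u ^+ k * iter k (succ_sum e) (fun v => al v ^+ k * phi v) u.
Proof.
move=> phi0; elim: k u => [|k IH] u; first by rewrite /= !expr0 !mul1r.
rewrite exprS -mulrA !iterS /weighted_sum ler_wpM2l//.
rewrite /succ_sum mulr_sumr; apply: ler_sum => v uv.
apply: le_trans (ler_wpM2l (al0 v) (IH v)) _.
rewrite mulrCA; apply: ler_pM; rewrite ?exprn_ge0//.
- by rewrite mulr_ge0// iter_succ_sum_ge0// => w; rewrite mulr_ge0 ?exprn_ge0.
- by rewrite lerXn2r ?nnegrE// be_ni.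
under [X in _ <= iter _ _ X _]funext do rewrite exprS -mulrA.
by apply: iter_succ_sum_push => w; rewrite mulr_ge0 ?exprn_ge0.
Qed.

(** The intermediate points of a path carry the full weight [al * be], and paths
    are monotone: this is the bound of an integral over increasing sequences by a
    power over a factorial. The last point is only bounded by the number of
    labels. *)
Lemma iter_weighted_sum_le k u : strict_integration e -> (forall v, be v <= 1) ->
  iter k.+1 (weighted_sum al be) (fun=> 1 : R) u
  <= al u * #|L|%:R * succ_sum e (fun v => al v * be v) u ^+ k / k`!%:R.
Proof.
move=> eI be1; elim: k u => [|k IH] u.
  rewrite expr0 divr1 mulr1 /= /weighted_sum ler_wpM2l//.
  rewrite /succ_sum -sumr_const big_mkcond/=; apply: ler_sum => v _.
  by case: ifP => // _; rewrite mulr1.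
rewrite iterS {1}/weighted_sum -!mulrA ler_wpM2l//.
have f0 v : 0 <= al v * be v by rewrite mulr_ge0.
have /(_ u k) := eI _ _ _ f0; set S := succ_sum e (fun v => al v * be v) => SI.
apply: (@le_trans _ _ (#|L|%:R / k`!%:R
    * succ_sum e (fun v => al v * be v * S v ^+ k) u)).
  rewrite /succ_sum mulr_sumr; apply: ler_sum => v _.
  apply: le_trans (ler_wpM2l (be0 v) (IH v)) _.
  by rewrite le_eqVlt; apply/orP; left; apply/eqP; rewrite /S; ring.
rewrite factS natrM invfM [leRHS](_ : _ = #|L|%:R / k`!%:R * (S u ^+ k.+1 / k.+1%:R)); last by ring.
by rewrite ler_wpM2l ?divr_ge0 ?ler0n// ler_pdivlMr ?ltr0n// mulrC.
Qed.

(** Replacing [al * be] by a smaller [f] allows a truncation to labels on which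
    the final value [phi] is not too small compared with [be]; [c] measures how
    small it may be. *)
Lemma iter_weighted_sum_ge k (c : R) (f phi : L -> R) u : weak_integration e ->
  0 <= c -> (forall v, 0 <= f v <= al v * be v) ->
  (forall v, c * f v <= al v * phi v) ->
  c * f u * succ_sum e f u ^+ k / k`!%:R
  <= al u * iter k (weighted_sum be al) phi u.
Proof.
move=> eI c0 f_le phi_ge; elim: k u => [|k IH] u.
  by rewrite expr0 divr1 mulr1; apply: phi_ge.
have f0 v : 0 <= f v by case/andP: (f_le v).
rewrite iterS {1}/weighted_sum mulrA.
set S := succ_sum e f; set T := succ_sum e _ u.
have T0 : S u ^+ k.+1 / k.+1`!%:R * c <= T.
  apply: (@le_trans _ _ (c / k`!%:R * succ_sum e (fun v => f v * S v ^+ k) u)).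
    rewrite factS natrM invfM.
    rewrite [leLHS](_ : _ = c / k`!%:R * (S u ^+ k.+1 / k.+1%:R)); last by ring.
    rewrite ler_wpM2l ?divr_ge0 ?ler0n// ler_pdivrMr ?ltr0n// mulrC; exact: eI.
  rewrite /T /succ_sum mulr_sumr; apply: ler_sum => v _; apply: le_trans (IH v).
  by rewrite le_eqVlt; apply/orP; left; apply/eqP; rewrite /S; ring.
have S0 : 0 <= S u ^+ k.+1 / k.+1`!%:R * c.
  by rewrite !mulr_ge0 ?invr_ge0 ?exprn_ge0 ?succ_sum_ge0.
rewrite [leLHS](_ : _ = f u * (S u ^+ k.+1 / k.+1`!%:R * c)); last by ring.
by apply: ler_pM => //; case/andP: (f_le u).
Qed.

End Spreading.
End Iterated.
End Telescoping.

(** * Bounds for the spine sums *)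

Section CaterpillarBounds.
Context (R : realFieldType) (L : finType) (e : rel L) (p d q : nat).
Variables (al be : L -> R) (cp cq : R).
Hypotheses (al01 : forall v, 0 <= al v <= 1) (be01 : forall v, 0 <= be v <= 1).
Hypothesis al_nd : forall u v, e u v -> al u <= al v.
Hypothesis be_ni : forall u v, e u v -> be v <= be u.
Hypotheses (cp0 : 0 <= cp) (cq0 : 0 <= cq).

Let al0 v : 0 <= al v. Proof. by case/andP: (al01 v). Qed.
Let be0 v : 0 <= be v. Proof. by case/andP: (be01 v). Qed.
Let al1 v : al v <= 1. Proof. by case/andP: (al01 v). Qed.
Let be1 v : be v <= 1. Proof. by case/andP: (be01 v). Qed.

Lemma iter_succ_sum_le k (phi psi : L -> R) u : (forall v, phi v <= psi v) ->
  iter k (succ_sum e) phi u <= iter k (succ_sum e) psi u.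
Proof.
move=> le; elim: k u => //= k IH u.
by rewrite /succ_sum; apply: ler_sum => v _; apply: IH.
Qed.

Lemma iter_succ_sumZ k c (phi : L -> R) u :
  iter k (succ_sum e) (fun v => c * phi v) u = c * iter k (succ_sum e) phi u.
Proof.
elim: k u => //= k IH u; rewrite /succ_sum mulr_sumr.
by apply: eq_bigr => v _; apply: IH.
Qed.

Lemma caterpillar_sum_ge0 k u : 0 <= caterpillar_sum R e p d q k u.
Proof.
elim: k u => //= k IH u; rewrite mulr_ge0 ?iter_succ_sum_ge0// => v.
by rewrite mulr_ge0 ?iter_succ_sum_ge0.
Qed.

Lemma caterpillar_sum_le_weighted k u :
  (forall v, iter p (succ_sum (fun x y => e y x)) (fun=> 1 : R) v <= cp * al v ^+ d) ->
  (forall v, iter q (succ_sum e) (fun=> 1 : R) v <= cq * be v ^+ d) ->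
  caterpillar_sum R e p d q k u
  <= (cp * cq) ^+ k * iter (k * d) (weighted_sum e al be) (fun=> 1) u.
Proof.
move=> down up; elim: k u => [|k IH] u; first by rewrite expr0 mul1r.
have X0 v : 0 <= iter (k * d) (weighted_sum e al be) (fun=> 1) v.
  exact: iter_weighted_sum_ge0.
rewrite mulSn iterD /=.
apply: (@le_trans _ _ (cp * al u ^+ d * iter d (succ_sum e) (fun v =>
    (cq * (cp * cq) ^+ k)
    * (be v ^+ d * iter (k * d) (weighted_sum e al be) (fun=> 1) v)) u)).
  apply: ler_pM => //; first exact: iter_succ_sum_ge0.
    by apply: iter_succ_sum_ge0 => v; rewrite mulr_ge0 ?iter_succ_sum_ge0 ?caterpillar_sum_ge0.
  apply: iter_succ_sum_le => v; rewrite mulrACA.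
  by apply: ler_pM => //; rewrite ?iter_succ_sum_ge0 ?caterpillar_sum_ge0.
rewrite iter_succ_sumZ exprS.
rewrite [leLHS](_ : _ = cp * cq * (cp * cq) ^+ k * (al u ^+ d * iter d (succ_sum e)
  (fun v => be v ^+ d * iter (k * d) (weighted_sum e al be) (fun=> 1) v) u)); last by ring.
by rewrite ler_wpM2l ?mulr_ge0 ?exprn_ge0 ?mulr_ge0// spread_weights_le.
Qed.

(** The extra factor [be u ^+ d], harmless because [be] is at most 1, lets each
    block of spine steps use the weight of the lower chains at its end and that
    of the upper chains at its start: the blocks are shifted by one gluing point
    against those of [caterpillar_sum_le_weighted]. *)
Lemma caterpillar_sum_ge_weighted k u :
  (forall v, cp * al v ^+ d <= iter p (succ_sum (fun x y => e y x)) (fun=> 1 : R) v) ->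
  (forall v, cq * be v ^+ d <= iter q (succ_sum e) (fun=> 1 : R) v) ->
  (cp * cq) ^+ k
    * (al u ^+ d * iter (k * d) (weighted_sum e be al) (fun v => be v ^+ d) u)
  <= be u ^+ d * caterpillar_sum R e p d q k u.
Proof.
move=> down up; elim: k u => [|k IH] u.
  by rewrite expr0 mul1r /= mulr1 ler_piMl ?exprn_ge0// exprn_ile1.
have X0 v : 0 <= iter (k * d) (weighted_sum e be al) (fun v => be v ^+ d) v.
  by apply: iter_weighted_sum_ge0 => // w; rewrite exprn_ge0.
rewrite mulSn iterD /=.
apply: (@le_trans _ _ (be u ^+ d * (cp * al u ^+ d * iter d (succ_sum e) (fun v =>
    (cq * (cp * cq) ^+ k) * (al v ^+ d *
       iter (k * d) (weighted_sum e be al) (fun v => be v ^+ d) v)) u))); last first.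
  rewrite ler_wpM2l ?exprn_ge0//; apply: ler_pM => //.
  - by rewrite mulr_ge0 ?exprn_ge0.
  - by apply: iter_succ_sum_ge0 => v; rewrite !mulr_ge0 ?exprn_ge0 ?mulr_ge0.
  apply: iter_succ_sum_le => v; rewrite -mulrA.
  apply: le_trans (ler_wpM2l cq0 (IH v)) _; rewrite mulrA.
  by rewrite ler_wpM2r ?caterpillar_sum_ge0.
rewrite iter_succ_sumZ exprS.
rewrite [leRHS](_ : _ = cp * cq * (cp * cq) ^+ k * (al u ^+ d *
  (be u ^+ d * iter d (succ_sum e) (fun v => al v ^+ d * 
    iter (k * d) (weighted_sum e be al) (fun v => be v ^+ d) v) u))); last by ring.
rewrite ler_wpM2l ?mulr_ge0 ?exprn_ge0 ?mulr_ge0// ler_wpM2l ?exprn_ge0//.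
exact: spread_weights_ge.
Qed.

Lemma sum_caterpillar_le k K : strict_integration R e -> (k * d = K.+1)%N ->
  (forall v, iter p (succ_sum (fun x y => e y x)) (fun=> 1 : R) v <= cp * al v ^+ d) ->
  (forall v, iter q (succ_sum e) (fun=> 1 : R) v <= cq * be v ^+ d) ->
  \sum_u caterpillar_sum R e p d q k u
  <= (cp * cq) ^+ k * (#|L|%:R ^+ 2 * (\sum_v al v * be v) ^+ K / K`!%:R).
Proof.
move=> eI kd down up.
have f0 v : 0 <= al v * be v by rewrite mulr_ge0.
apply: (@le_trans _ _ (\sum_(u : L) (cp * cq) ^+ k
    * (#|L|%:R * (\sum_v al v * be v) ^+ K / K`!%:R))); last first.
  by rewrite sumr_const -mulr_natr le_eqVlt; apply/orP; left; apply/eqP; ring.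
apply: ler_sum => u _; apply: le_trans (caterpillar_sum_le_weighted k u down up) _.
rewrite kd ler_wpM2l ?exprn_ge0 ?mulr_ge0//.
apply: le_trans (iter_weighted_sum_le al0 be0 K u eI be1) _.
rewrite ler_wpM2r ?invr_ge0 ?ler0n//; apply: ler_pM.
- by rewrite mulr_ge0 ?ler0n.
- by rewrite exprn_ge0 ?succ_sum_ge0.
- by rewrite ler_piMl ?ler0n.
rewrite lerXn2r ?nnegrE ?succ_sum_ge0 ?sumr_ge0//.
by rewrite /succ_sum big_mkcond/=; apply: ler_sum => v _; case: ifP.
Qed.

(** The bounds [dp] and [dq] on the support of [f] pay for the weights at both
    ends of the spine, which have no neighbouring block to be shared with. *)
Lemma sum_caterpillar_ge k r (f : L -> R) (dp dq : R) : weak_integration R e ->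
  (0 < d)%N -> (forall v, e r v) -> 0 <= dp -> 0 <= dq ->
  (forall v, 0 <= f v <= al v * be v) ->
  (forall v, f v != 0 -> dp <= al v ^+ d /\ dq <= be v ^+ d) ->
  (forall v, cp * al v ^+ d <= iter p (succ_sum (fun x y => e y x)) (fun=> 1 : R) v) ->
  (forall v, cq * be v ^+ d <= iter q (succ_sum e) (fun=> 1 : R) v) ->
  (cp * cq) ^+ k * (dp * dq * (\sum_v f v) ^+ (k * d).+1 / (k * d).+1`!%:R)
  <= \sum_u caterpillar_sum R e p d q k u.
Proof.
move=> eI d0 rmin dp0 dq0 f_le f_supp down up.
have f0 v : 0 <= f v by case/andP: (f_le v).
have C0 : 0 <= (cp * cq) ^+ k by rewrite exprn_ge0 ?mulr_ge0.
set K := (k * d)%N; pose S := succ_sum e f.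
have SrE : S r = \sum_v f v.
  by rewrite /S /succ_sum; apply: eq_bigl => v; rewrite rmin.
have S0 v : 0 <= S v by apply: succ_sum_ge0.
apply: (@le_trans _ _ ((cp * cq) ^+ k *
    \sum_u dp * (dq * f u * S u ^+ K / K`!%:R))).
  rewrite ler_wpM2l//.
  have -> : \sum_u dp * (dq * f u * S u ^+ K / K`!%:R)
      = dp * dq / K`!%:R * succ_sum e (fun v => f v * S v ^+ K) r.
    rewrite /succ_sum mulr_sumr; apply: eq_big => [v|v _]; first by rewrite rmin.
    by ring.
  rewrite factS natrM invfM -SrE.
  rewrite [leLHS](_ : _ = dp * dq / K`!%:R * (S r ^+ K.+1 / K.+1%:R)); last by ring.
  rewrite ler_wpM2l ?mulr_ge0 ?invr_ge0 ?ler0n// ler_pdivrMr ?ltr0n// mulrC.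
  exact: eI.
rewrite mulr_sumr; apply: ler_sum => u _.
have cat0 := caterpillar_sum_ge0 k u.
apply: (@le_trans _ _ (be u ^+ d * caterpillar_sum R e p d q k u)); last first.
  by rewrite ler_piMl// exprn_ile1.
apply: le_trans (caterpillar_sum_ge_weighted k u down up); rewrite ler_wpM2l//.
have [f0u|fN0] := eqVneq (f u) 0.
  rewrite f0u mulr0 !mul0r mulr0 mulr_ge0 ?exprn_ge0// iter_weighted_sum_ge0//.
  by move=> v; rewrite exprn_ge0.
have [dpu dqu] := f_supp u fN0.
set X := iter _ _ _ u.
have -> : al u ^+ d * X = al u ^+ d.-1 * (al u * X).
  by rewrite mulrA -exprSr prednK.
apply: ler_pM => //.
- by rewrite !mulr_ge0 ?invr_ge0 ?exprn_ge0.
- apply: le_trans dpu _.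
  by apply: (ler_wiXn2l (al0 u) (al1 u)); exact: leq_pred.
apply: iter_weighted_sum_ge => // v.
have [->|fv] := eqVneq (f v) 0; first by rewrite mulr0 mulr_ge0 ?exprn_ge0.
have [_ dqv] := f_supp v fv; rewrite mulrC; apply: ler_pM => //.
case/andP: (f_le v) => _ /le_trans; apply.
by rewrite ler_piMr.
Qed.

End CaterpillarBounds.

(** * Riemann sums of a product of monotone functions *)

Section RiemannSums.
Context (R : realType) (f : R -> R).
Local Notation mu := (@lebesgue_measure R).
Hypothesis intf : mu.-integrable `[0, 1]%classic (EFin \o f).

Lemma integrable_cst_itv (a b c : R) :
  mu.-integrable `]a, b]%classic (EFin \o fun=> c).
Proof.
apply: measurable_bounded_integrable => //=.
  by rewrite lebesgue_measure_itv /=; case: ifP => // _; rewrite -EFinD ltry.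
by exists `|c|; split => // M cM x _ /=; exact: ltW.
Qed.

Lemma Rintegral_cst_itv (a b c : R) : a <= b ->
  \int[mu]_(x in `]a, b]) c = c * (b - a).
Proof.
move=> ab; rewrite Rintegral_cst//= lebesgue_measure_itv /= lte_fin.
case: ltP => [_|ba]; first by rewrite -EFinB.
by rewrite (le_anti (introT andP (conj ab ba))) subrr.
Qed.

Lemma Rintegral_ge_cst (a b c : R) : 0 <= a -> a <= b -> b <= 1 ->
  (forall x, a < x <= b -> c <= f x) -> c * (b - a) <= \int[mu]_(x in `]a, b]) f x.
Proof.
move=> a0 ab b1 cf; rewrite -Rintegral_cst_itv//; apply: le_Rintegral => //=.
- exact: integrable_cst_itv.
- apply: integrableS intf => //; apply: subset_itv; rewrite bnd_simp//.
Qed.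

Lemma Rintegral_le_cst (a b c : R) : 0 <= a -> a <= b -> b <= 1 ->
  (forall x, a < x <= b -> f x <= c) -> \int[mu]_(x in `]a, b]) f x <= c * (b - a).
Proof.
move=> a0 ab b1 cf; rewrite -Rintegral_cst_itv//; apply: le_Rintegral => //=.
- apply: integrableS intf => //; apply: subset_itv; rewrite bnd_simp//.
- exact: integrable_cst_itv.
Qed.

Lemma Rintegral_subdivision t k : (0 < t)%N -> (k <= t)%N ->
  \int[mu]_(x in `[0, k%:R / t%:R]) f x
  = \sum_(0 <= i < k) \int[mu]_(x in `]i%:R / t%:R, i.+1%:R / t%:R]) f x.
Proof.
move=> t0; elim: k => [|k IH] kt.
  by rewrite mul0r big_nil set_itv1 Rintegral_set1.
have tR : 0 < t%:R :> R by rewrite ltr0n.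
rewrite big_nat_recr//= -IH; last exact: ltnW.
rewrite -(@Rintegral_itvB _ f (BLeft 0) (BRight (k.+1%:R / t%:R)) (k%:R / t%:R)).
- by rewrite addrC subrK.
- apply: integrableS intf => //; apply: subset_itvl; rewrite bnd_simp.
  by rewrite ler_pdivrMr// mul1r ler_nat.
- by rewrite bnd_simp divr_ge0.
- by rewrite bnd_simp ler_pM2r ?invr_gt0// ler_nat.
Qed.

Section Product.
Variables (g h : R -> R).
Hypotheses (g01 : forall x : R, 0 <= x <= 1 -> 0 <= g x <= 1)
           (h01 : forall x : R, 0 <= x <= 1 -> 0 <= h x <= 1).
Hypothesis g_nd : forall x y : R, 0 <= x -> x <= y -> y <= 1 -> g x <= g y.
Hypothesis h_ni : forall x y : R, 0 <= x -> x <= y -> y <= 1 -> h y <= h x.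
Hypothesis fE : forall x, f x = g x * h x.

Let unit_frac t i : (0 < t)%N -> (i <= t)%N -> 0 <= (i%:R / t%:R : R) <= 1.
Proof.
by move=> t0 it; rewrite divr_ge0//= ler_pdivrMr ?ltr0n// mul1r ler_nat.
Qed.

Lemma lower_sum_le_Rintegral t : (0 < t)%N ->
  \sum_(0 <= i < t) g (i%:R / t%:R) * h (i.+1%:R / t%:R)
  <= t%:R * \int[mu]_(x in `[0, 1]) f x.
Proof.
move=> t0; have tR : 0 < t%:R :> R by rewrite ltr0n.
rewrite -[X in `[0, X]](@divff _ t%:R) ?gt_eqF// Rintegral_subdivision//.
rewrite mulr_sumr; apply: ler_sum_nat => i /andP[_ it].
have /andP[i0 i1] := unit_frac t0 (ltnW it); have /andP[j0 j1] := unit_frac t0 it.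
have ij : i%:R / t%:R <= i.+1%:R / t%:R :> R.
  by rewrite ler_pM2r ?invr_gt0// ler_nat.
rewrite -ler_pdivrMl//.
apply: le_trans (@Rintegral_ge_cst _ _ (g (i%:R / t%:R) * h (i.+1%:R / t%:R)) i0 ij j1 _).
  by rewrite -mulrBl -natrB// subSnn mul1r mulrC.
move=> x /andP[ix xj]; rewrite fE; apply: ler_pM.
- by case/andP: (g01 (unit_frac t0 (ltnW it))).
- by case/andP: (h01 (unit_frac t0 it)).
- by apply: g_nd => //; [exact: ltW|exact: le_trans xj j1].
- by apply: h_ni => //; exact: le_trans i0 (ltW ix).
Qed.

Lemma Rintegral_le_upper_sum t : (0 < t)%N ->
  t%:R * \int[mu]_(x in `[0, 1]) f x
  <= \sum_(0 <= i < t) g (i.+1%:R / t%:R) * h (i%:R / t%:R).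
Proof.
move=> t0; have tR : 0 < t%:R :> R by rewrite ltr0n.
rewrite -[X in `[0, X]](@divff _ t%:R) ?gt_eqF// Rintegral_subdivision//.
rewrite mulr_sumr; apply: ler_sum_nat => i /andP[_ it].
have /andP[i0 i1] := unit_frac t0 (ltnW it); have /andP[j0 j1] := unit_frac t0 it.
have ij : i%:R / t%:R <= i.+1%:R / t%:R :> R.
  by rewrite ler_pM2r ?invr_gt0// ler_nat.
rewrite -ler_pdivlMl//.
apply: le_trans (@Rintegral_le_cst _ _ (g (i.+1%:R / t%:R) * h (i%:R / t%:R)) i0 ij j1 _) _.
  move=> x /andP[ix xj]; rewrite fE.
  have x01 : 0 <= x <= 1 by rewrite (le_trans i0 (ltW ix)) (le_trans xj j1).
  apply: ler_pM.
  - by case/andP: (g01 x01).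
  - by case/andP: (h01 x01).
  - by apply: g_nd => //; case/andP: x01.
  - by apply: h_ni => //; [exact: ltW|case/andP: x01].
by rewrite -mulrBl -natrB// subSnn mul1r mulrC.
Qed.

(** With one nondecreasing and one nonincreasing factor, the total oscillation
    telescopes, which bounds the error without any modulus of continuity. *)
Lemma Riemann_sum_le t : (0 < t)%N ->
  \sum_(v < t.+1) f (v%:R / t%:R) <= t%:R * \int[mu]_(x in `[0, 1]) f x + 2.
Proof.
move=> t0; apply: le_trans (lerD (lower_sum_le_Rintegral t0) (lexx _)).
rewrite -(big_mkord xpredT (fun i => f (i%:R / t%:R))) big_nat_recr//= -lerBlDl -addrAC.
rewrite -sumrB.
have h1 : f (t%:R / t%:R) <= 1.
  have x01 := unit_frac t0 (leqnn t); rewrite fE.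
  by case/andP: (g01 x01) => ? ?; case/andP: (h01 x01) => ? ?; rewrite mulr_ile1.
have -> : 2 = 1 + 1 :> R by [].
apply: lerD => //; apply: (@le_trans _ _
  (\sum_(0 <= i < t) - (h (i.+1%:R / t%:R) - h (i%:R / t%:R)))).
  apply: ler_sum_nat => i /andP[_ it]; rewrite fE -mulrBr opprB.
  have x01 := unit_frac t0 (ltnW it).
  rewrite ler_piMl//; last by case/andP: (g01 x01).
  rewrite subr_ge0; apply: h_ni; first by case/andP: x01.
    by rewrite ler_pM2r ?invr_gt0 ?ltr0n// ler_nat.
  by case/andP: (unit_frac t0 it).
rewrite sumrN telescope_sumr// opprB lerBlDr.
case/andP: (h01 (unit_frac t0 (leq0n t))) => _ /le_trans; apply.
by rewrite lerDl; case/andP: (h01 (unit_frac t0 (leqnn t))).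
Qed.

Lemma Riemann_sum_ge t : (0 < t)%N ->
  t%:R * \int[mu]_(x in `[0, 1]) f x - 1 <= \sum_(v < t.+1) f (v%:R / t%:R).
Proof.
move=> t0; rewrite lerBlDr; apply: le_trans (Rintegral_le_upper_sum t0) _.
rewrite -(big_mkord xpredT (fun i => f (i%:R / t%:R))) big_nat_recr//= -lerBlDl.
rewrite opprD addrA -sumrB lerBlDr.
apply: (@le_trans _ _ (\sum_(0 <= i < t) (g (i.+1%:R / t%:R) - g (i%:R / t%:R)))).
  apply: ler_sum_nat => i /andP[_ it]; rewrite fE -mulrBl.
  have x01 := unit_frac t0 (ltnW it).
  rewrite ler_piMr//; last by case/andP: (h01 x01).
  rewrite subr_ge0; apply: g_nd; first by case/andP: x01.
    by rewrite ler_pM2r ?invr_gt0 ?ltr0n// ler_nat.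
  by case/andP: (unit_frac t0 it).
rewrite telescope_sumr// lerBlDr.
case/andP: (g01 (unit_frac t0 (leqnn t))) => _ /le_trans; apply.
rewrite -addrA lerDl addr_ge0//; last by case/andP: (g01 (unit_frac t0 (leq0n t))).
have x01 := unit_frac t0 (leqnn t); rewrite fE.
by case/andP: (g01 x01) => ? ?; case/andP: (h01 x01) => ? ?; rewrite mulr_ge0.
Qed.
End Product.
End RiemannSums.

(** * The Beta weight *)

Section FractionalPowers.
Context (R : realType) (d : nat) (d0 : (0 < d)%N).

Definition frac_pow (p : nat) (x : R) : R := x `^ (p%:R / d%:R).

Lemma frac_pow_ge0 p x : 0 <= frac_pow p x.
Proof. exact: powR_ge0. Qed.

Lemma frac_pow_nd p (x y : R) : 0 <= x -> x <= y -> frac_pow p x <= frac_pow p y.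
Proof.
move=> x0 xy; have y0 := le_trans x0 xy.
by apply: ge0_ler_powR; rewrite ?nnegrE ?divr_ge0.
Qed.

Lemma frac_pow_01 p (x : R) : 0 <= x <= 1 -> 0 <= frac_pow p x <= 1.
Proof.
move=> /andP[x0 x1]; rewrite frac_pow_ge0/=.
by apply: le_trans (frac_pow_nd p x0 x1) _; rewrite /frac_pow powR1.
Qed.

Lemma frac_powX p (x : R) : 0 <= x -> frac_pow p x ^+ d = x ^+ p.
Proof.
move=> x0; rewrite /frac_pow -powR_mulrn ?powR_ge0// -powRrM divfK ?powR_mulrn//.
by rewrite pnatr_eq0 -lt0n.
Qed.

Lemma frac_pow_gt0 p (x : R) : 0 < x -> 0 < frac_pow p x.
Proof. exact: powR_gt0. Qed.

Lemma measurable_frac_pow p : measurable_fun setT (frac_pow p).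
Proof. exact: measurable_powR. Qed.

Definition beta_weight (p q : nat) (x : R) : R := frac_pow p x * frac_pow q (1 - x).

Lemma beta_weight_01 p q (x : R) : 0 <= x <= 1 -> 0 <= beta_weight p q x <= 1.
Proof.
move=> x01; have y01 : 0 <= 1 - x <= 1 by move: x01; lra.
have /andP[? ?] := frac_pow_01 p x01; have /andP[? ?] := frac_pow_01 q y01.
by rewrite /beta_weight mulr_ge0//= mulr_ile1.
Qed.

Lemma integrable_beta_weight p q :
  (@lebesgue_measure R).-integrable `[0, 1]%classic (EFin \o beta_weight p q).
Proof.
apply: measurable_bounded_integrable => //=.
- by rewrite lebesgue_measure_itv /=; case: ifP => // _; rewrite -EFinD ltry.
- apply: measurable_funTS; apply: measurable_funM; first exact: measurable_frac_pow.
  apply: (measurableT_comp (measurable_frac_pow q)).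
  exact: measurable_funB.
exists 1; split => // M M1 x /=; rewrite in_itv/= => x01.
have /andP[w0 w1] := beta_weight_01 p q x01.
by rewrite ger0_norm// (le_trans w1)// ltW.
Qed.

Lemma Beta_beta_weight (p q : nat) :
  Beta (p%:R / d%:R + 1) (q%:R / d%:R + 1)
  = \int[@lebesgue_measure R]_(x in `[0, 1]) beta_weight p q x.
Proof. by rewrite /Beta !addrK. Qed.

Section BetaSums.
Variables p q : nat.
Local Notation B := (Beta (p%:R / d%:R + 1) (q%:R / d%:R + 1) : R).

Let g01 (x : R) : 0 <= x <= 1 -> 0 <= frac_pow p x <= 1 := @frac_pow_01 p x.
Let h01 (x : R) : 0 <= x <= 1 -> 0 <= frac_pow q (1 - x) <= 1.
Proof. by move=> x01; apply: frac_pow_01; move: x01; lra. Qed.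
Let g_nd (x y : R) : 0 <= x -> x <= y -> y <= 1 -> frac_pow p x <= frac_pow p y.
Proof. by move=> x0 xy _; apply: frac_pow_nd. Qed.
Let h_ni (x y : R) : 0 <= x -> x <= y -> y <= 1 ->
  frac_pow q (1 - y) <= frac_pow q (1 - x).
Proof. by move=> x0 xy y1; apply: frac_pow_nd; lra. Qed.

Lemma beta_weight_sum_le t : (0 < t)%N ->
  \sum_(v < t.+1) beta_weight p q (v%:R / t%:R) <= t%:R * B + 2.
Proof.
move=> t0; rewrite Beta_beta_weight.
exact: (Riemann_sum_le (integrable_beta_weight p q) g01 h01 g_nd h_ni).
Qed.

Lemma beta_weight_sum_ge t : (0 < t)%N ->
  t%:R * B - 1 <= \sum_(v < t.+1) beta_weight p q (v%:R / t%:R).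
Proof.
move=> t0; rewrite Beta_beta_weight.
exact: (Riemann_sum_ge (integrable_beta_weight p q) g01 h01 g_nd h_ni).
Qed.

(** A lower sum with three intervals is positive, because its middle term takes
    both factors at interior points. *)
Lemma Beta_gt0 : 0 < B.
Proof.
have := lower_sum_le_Rintegral (integrable_beta_weight p q) g01 h01 g_nd h_ni
  (fun=> erefl) (isT : (0 < 3)%N).
rewrite -Beta_beta_weight -(pmulr_rgt0 _ (ltr0Sn R 2)); apply: lt_le_trans.
rewrite -[X in index_iota _ X]/(1 + 1 + 1)%N /index_iota /= !big_cons big_nil addr0.
rewrite addrCA ltr_wpDr//.
  by rewrite addr_ge0// mulr_ge0// frac_pow_ge0.
by rewrite mulr_gt0// frac_pow_gt0//; lra.
Qed.

Lemma Beta_le1 : B <= 1.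
Proof.
have := Rintegral_le_upper_sum (integrable_beta_weight p q) g01 h01 g_nd h_ni
  (fun=> erefl) (isT : (0 < 1)%N).
rewrite -Beta_beta_weight big_nat1 mul1r => /le_trans; apply.
by rewrite divr1 mul0r subr0 /frac_pow !powR1 mulr1.
Qed.
End BetaSums.
End FractionalPowers.

(** * Bounds with finitely many labels *)

Section DiscreteBounds.
Context (R : realType) (p d q n t : nat) (hab : (0 < p.+1 < (p + d).+1)%N).
Hypothesis t0 : (0 < t)%N.

Local Notation P := (cluster_poset (p + d + q).+1 p.+1 (p + d).+1 n.+1 hab).
Local Notation K := (n.+1 * d)%N.
Local Notation tR := (t%:R : R).

Let d0 : (0 < d)%N. Proof. by move: hab; lia. Qed.
Let tR0 : 0 < tR. Proof. by rewrite ltr0n. Qed.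

Definition scaled (v : 'I_t.+1) : R := v%:R / tR.

Lemma scaled_01 v : 0 <= scaled v <= 1.
Proof.
by rewrite /scaled divr_ge0//= ler_pdivrMr// mul1r ler_nat -ltnS.
Qed.

Lemma onem_scaled v : 1 - scaled v = (t - v)%:R / tR.
Proof.
by rewrite natrB ?mulrBl ?divff ?gt_eqF// -ltnS.
Qed.

Let al (v : 'I_t.+1) : R := frac_pow d p (scaled v).
Let be (v : 'I_t.+1) : R := frac_pow d q (1 - scaled v).

Let al01 v : 0 <= al v <= 1.
Proof. exact/frac_pow_01/scaled_01. Qed.
Let be01 v : 0 <= be v <= 1.
Proof. by apply: frac_pow_01; have := scaled_01 v; lra. Qed.
Let al_nd (u v : 'I_t.+1) : (u <= v)%N -> al u <= al v.
Proof.
move=> uv; apply: frac_pow_nd; first by case/andP: (scaled_01 u).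
by rewrite ler_pM2r ?invr_gt0// ler_nat.
Qed.
Let be_ni (u v : 'I_t.+1) : (u <= v)%N -> be v <= be u.
Proof.
move=> uv; apply: frac_pow_nd; first by case/andP: (scaled_01 v) => *; lra.
by rewrite lerD2l lerN2 ler_pM2r ?invr_gt0// ler_nat.
Qed.

Let cp : R := tR ^+ p / p`!%:R.
Let cq : R := tR ^+ q / q`!%:R.
Let cp0 : 0 <= cp. Proof. by rewrite divr_ge0 ?exprn_ge0. Qed.
Let cq0 : 0 <= cq. Proof. by rewrite divr_ge0 ?exprn_ge0. Qed.

Let cp_al v : cp * al v ^+ d = v%:R ^+ p / p`!%:R.
Proof.
rewrite frac_powX//; last by case/andP: (scaled_01 v).
by rewrite /cp /scaled expr_div_n mulrAC mulrCA mulfV ?mulr1// expf_neq0 ?gt_eqF.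
Qed.

Let cq_be v : cq * be v ^+ d = (t - v)%:R ^+ q / q`!%:R.
Proof.
rewrite frac_powX//; last by case/andP: (scaled_01 v) => *; lra.
by rewrite /cq onem_scaled expr_div_n mulrAC mulrCA mulfV ?mulr1// expf_neq0 ?gt_eqF.
Qed.

Let card_below (r : nat) : (r <= t.+1)%N ->
  \sum_(v : 'I_t.+1 | (v < r)%N) (1 : R) = r%:R.
Proof. by move=> rt; rewrite sum_ord_lt// big_const_nat iter_addr_0 subn0. Qed.

Local Notation C := (tR ^+ (p + q) / (p`! * q`!)%:R).
Let CE : cp * cq = C.
Proof. by rewrite /cp /cq mulf_div -exprD -natrM. Qed.

Let card_above (u : 'I_t.+1) :
  \sum_(v : 'I_t.+1 | (u < v)%N) (1 : R) = (t - u)%:R.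
Proof. by rewrite sum_ord_gt card_below// leq_subr. Qed.

Lemma linear_extensions_le_discrete :
  (num_linear_extensions P * 'C(t.+1, #|P|))%:R
  <= C ^+ n.+1 * (t.+1%:R ^+ 2
       * (tR * Beta (p%:R / d%:R + 1) (q%:R / d%:R + 1) + 2) ^+ K.-1 / K.-1`!%:R).
Proof.
apply: le_trans (@linear_extensions_le_strict p d q n hab R t) _.
have KE : (n.+1 * d = K.-1.+1)%N by rewrite prednK// muln_gt0.
have := @sum_caterpillar_le R _ (fun i j : 'I_t.+1 => (i < j)%N) p d q al be cp cq
  al01 be01 (fun u v uv => al_nd (ltnW uv)) (fun u v uv => be_ni (ltnW uv)) cp0 cq0
  n.+1 K.-1 (@strict_integration_lt R t) KE.
rewrite card_ord CE => le_sum; apply: le_trans (le_sum _ _) _.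
- move=> v; rewrite cp_al.
  apply: le_trans (iter_succ_sum1_le _ _ (@strict_integration_gt R t)) _.
  by rewrite /succ_sum card_below// ltnW.
- move=> v; rewrite cq_be.
  apply: le_trans (iter_succ_sum1_le _ _ (@strict_integration_lt R t)) _.
  by rewrite /succ_sum card_above.
rewrite ler_wpM2l ?exprn_ge0 ?divr_ge0 ?exprn_ge0//.
rewrite ler_pM2r ?invr_gt0 ?ltr0n ?fact_gt0// ler_pM2l ?exprn_gt0//.
have S0 : 0 <= \sum_v al v * be v.
  apply: sumr_ge0 => v _; case/andP: (al01 v) => ? _; case/andP: (be01 v) => ? _.
  by rewrite mulr_ge0.
have S_le := @beta_weight_sum_le R d p q t t0.
by rewrite lerXn2r ?nnegrE// (le_trans S0).
Qed.

(** Only spines with all labels in [eps t, (1 - eps) t] are kept; outside there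
    are at most 2 (eps t + 1) labels, each of weight at most 1. *)
Lemma linear_extensions_ge_discrete (eps : R) : 0 <= eps <= 1 ->
  let B := Beta (p%:R / d%:R + 1) (q%:R / d%:R + 1) in
  0 <= tR * B - 1 - 2 * (eps * tR + 1) ->
  C ^+ n.+1 * (eps ^+ (p + q) * (tR * B - 1 - 2 * (eps * tR + 1)) ^+ K.+1 / K.+1`!%:R)
  <= (num_linear_extensions P * 'C(t.+1, #|P|)
      + (t.+1 ^ #|P| - t.+1 ^_ #|P|))%:R.
Proof.
move=> /andP[eps0 eps1] B Bpos.
apply: le_trans (@weak_le_linear_extensions p d q n hab R t).
pose f (v : 'I_t.+1) : R :=
  if (eps <= scaled v) && (eps <= 1 - scaled v) then al v * be v else 0.
have albe0 v : 0 <= al v * be v.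
  by case/andP: (al01 v) => ? _; case/andP: (be01 v) => ? _; rewrite mulr_ge0.
have f_le v : 0 <= f v <= al v * be v.
  by rewrite /f; case: ifP => _; rewrite ?lexx albe0.
have f_supp v : f v != 0 -> eps ^+ p <= al v ^+ d /\ eps ^+ q <= be v ^+ d.
  rewrite /f; case: ifP => [/andP[e1 e2] _|_]; last by rewrite eqxx.
  by rewrite !frac_powX//; [rewrite !lerXn2r ?nnegrE//; lra|lra|lra].
have := @sum_caterpillar_ge R _ (fun i j : 'I_t.+1 => (i <= j)%N) p d q al be cp cq
  al01 be01 al_nd be_ni cp0 cq0 n.+1 ord0 f (eps ^+ p) (eps ^+ q)
  (@weak_integration_le R t) d0 (fun v => leq0n v)
  (exprn_ge0 p eps0) (exprn_ge0 q eps0) f_le f_supp.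
rewrite CE => sum_ge; apply: le_trans (sum_ge _ _).
- rewrite ler_wpM2l ?exprn_ge0 ?divr_ge0 ?exprn_ge0// -exprD.
  rewrite ler_pM2r ?invr_gt0 ?ltr0n ?fact_gt0// ler_wpM2l ?exprn_ge0//.
  have few_low : \sum_(v : 'I_t.+1 | ~~ (eps <= scaled v)) (1 : R) <= eps * tR + 1.
    pose r := (Num.truncn (eps * tR)).+1.
    have r_gt : eps * tR < r%:R by apply: truncnS_gt.
    have r_le : (Num.truncn (eps * tR))%:R <= eps * tR.
      by rewrite truncn_le mulr_ge0// ltW.
    have rt : (r <= t.+1)%N.
      by rewrite ltnS -(ler_nat R) (le_trans r_le)// ler_piMl// ltW.
    apply: (@le_trans _ _ r%:R); last by rewrite -natr1 lerD2r.
    rewrite -card_below// big_mkcond [leRHS]big_mkcond/=; apply: ler_sum => v _.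
    rewrite -ltNge ltr_pdivrMr//; case: ltP => [v_lt|_]; last by case: ifP.
    by rewrite -(ltr_nat R) (lt_trans v_lt).
  have few_high : \sum_(v : 'I_t.+1 | ~~ (eps <= 1 - scaled v)) (1 : R) <= eps * tR + 1.
    apply: le_trans few_low; rewrite (reindex_inj rev_ord_inj)/=.
    rewrite le_eqVlt; apply/orP; left; apply/eqP; apply: eq_bigl => v.
    rewrite onem_scaled /scaled/= subSS; congr (~~ (_ <= _%:R / _)).
    by have := ltn_ord v; lia.
  rewrite lerXn2r ?nnegrE// ?sumr_ge0//; first by move=> v _; case/andP: (f_le v).
  have S_ge := @beta_weight_sum_ge R d p q t t0.
  apply: (@le_trans _ _ (\sum_(v : 'I_t.+1) (al v * be v)
     - \sum_(v : 'I_t.+1 | ~~ (eps <= scaled v)) (1 : R)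
     - \sum_(v : 'I_t.+1 | ~~ (eps <= 1 - scaled v)) (1 : R))).
    move: S_ge few_low few_high; rewrite -/B /beta_weight /al /be /scaled.
    set S := \sum_(_ < _) _; lra.
  rewrite [X in _ - X - _]big_mkcond [X in _ - _ - X]big_mkcond /= -!sumrB.
  apply: ler_sum => v _; have ab1 : al v * be v <= 1.
    by case/andP: (al01 v) => ? ?; case/andP: (be01 v) => ? ?; rewrite mulr_ile1.
  by rewrite /f; case: (eps <= scaled v); case: (eps <= 1 - scaled v) => /=; lra.
- move=> v; rewrite cp_al.
  apply: le_trans (iter_succ_sum1_ge _ _ (@weak_integration_ge R t)).
  rewrite ler_pM2r ?invr_gt0 ?ltr0n ?fact_gt0// lerXn2r ?nnegrE//.
    by rewrite succ_sum_ge0.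
  by rewrite /succ_sum (card_below (r := v.+1))// ler_nat.
- move=> v; rewrite cq_be.
  apply: le_trans (iter_succ_sum1_ge _ _ (@weak_integration_le R t)).
  rewrite ler_pM2r ?invr_gt0 ?ltr0n ?fact_gt0// lerXn2r ?nnegrE//.
    by rewrite succ_sum_ge0.
  rewrite /succ_sum sum_ord_ge (card_below (r := (rev_ord v).+1))// ler_nat.
  by rewrite /= subSS.
Qed.
End DiscreteBounds.

(** * Letting the number of labels tend to infinity *)

Section ContinuumLimit.
Context (R : realType) (p d q n : nat) (hab : (0 < p.+1 < (p + d).+1)%N).

Local Notation P := (cluster_poset (p + d + q).+1 p.+1 (p + d).+1 n.+1 hab).
Local Notation K := (n.+1 * d)%N.
Local Notation c := ((p`! * q`!)%:R : R).
Local Notation B := (Beta (p%:R / d%:R + 1) (q%:R / d%:R + 1) : R).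
Local Notation e := (num_linear_extensions P).

Local Notation N := (n.+1 * (p + d + q)).+1.
Let d0 : (0 < d)%N. Proof. by move: hab; lia. Qed.

(** Falling factorials are between two powers that are equivalent for large t. *)
Lemma ffact_bounds t k : ((t - k) ^ k <= t.+1 ^_ k <= t.+1 ^ k)%N.
Proof.
have pow m : (m ^ k = \prod_(i < k) m)%N by rewrite big_const_ord iter_muln_1.
rewrite ffact_prod !pow; apply/andP; split; apply: leq_prod => i _.
  by have := ltn_ord i; lia.
exact: leq_subr.
Qed.

Lemma cvg_affine_harmonicX (a b : R) k :
  ((a + b * harmonic s) ^+ k @[s --> \oo] --> a ^+ k)%classic.
Proof.
apply: (@cvg_comp _ _ _ (fun s => a + b * harmonic s) (fun x : R => x ^+ k) _
  (nbhs a)); last exact: exprn_continuous.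
suff : (a + b * harmonic s @[s --> \oo] --> a + b * 0)%classic.
  by rewrite mulr0 addr0.
by apply: cvgD; [exact: cvg_cst|apply: cvgMl_tmp; exact: cvg_harmonic].
Qed.

Let binE t : ('C(t, N))%:R = (t ^_ N)%:R / N`!%:R :> R.
Proof.
by rewrite -bin_ffact natrM mulfK// pnatr_eq0 -lt0n fact_gt0.
Qed.

Let powN (T : R) : T ^+ N = (T ^+ (p + q)) ^+ n.+1 * T ^+ 2 * T ^+ K.-1.
Proof.
rewrite -exprM -!exprD; congr (_ ^+ _).
by have := muln_gt0 n.+1 d; rewrite d0 /=; nia.
Qed.

(** After division by t ^ |P|, both sides of the discrete bound are polynomials
    in 1 / t, and their constant terms are compared. *)
Lemma linear_extensions_le :
  e%:R / N`!%:R <= c ^- n.+1 * (B ^+ K.-1 / K.-1`!%:R).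
Proof.
pose F s : R := e%:R / N`!%:R * (1 + - N%:R * harmonic s) ^+ N.
pose G s : R := c ^- n.+1 / K.-1`!%:R *
  ((1 + 1 * harmonic s) ^+ 2 * (B + 2 * harmonic s) ^+ K.-1).
have cF : (F s @[s --> \oo] --> (e%:R / N`!%:R * 1 ^+ N : R))%classic.
  by apply: cvgMl_tmp; exact: cvg_affine_harmonicX.
have cG : (G s @[s --> \oo] --> (c ^- n.+1 / K.-1`!%:R * (1 ^+ 2 * B ^+ K.-1) : R))%classic.
  by apply: cvgMl_tmp; apply: cvgM; exact: cvg_affine_harmonicX.
suff FG : (\forall s \near \oo, F s <= G s)%classic.
  have /(_ eventually_filter) := ler_cvg_to cF cG FG.
  by rewrite !expr1n mulr1 mul1r mulrAC -mulrA.
near=> s.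
pose t := s.+1; pose T : R := t%:R.
have T0 : 0 < T by rewrite ltr0n.
have tN : (N <= t)%N.
  by apply: leqW; near: s; exists N.
have := @linear_extensions_le_discrete R p d q n t hab (ltn0Sn s).
rewrite natrM card_cluster_poset binE => le_disc.
have /andP[ff_ge _] := ffact_bounds t N.
have le2 : e%:R * ((T - N%:R) ^+ N / N`!%:R) <= e%:R * ((t.+1 ^_ N)%:R / N`!%:R) :> R.
  rewrite ler_wpM2l ?ler0n// ler_pM2r ?invr_gt0 ?ltr0n ?fact_gt0//.
  by rewrite /T -natrB// -natrX ler_nat.
have := le_trans le2 le_disc.
rewrite /F /G /harmonic -/t -/T -[t.+1%:R]natr1 -/T.
have -> : 1 + - N%:R * T^-1 = (T - N%:R) / T by field; rewrite gt_eqF.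
have -> : 1 + 1 * T^-1 = (T + 1) / T by field; rewrite gt_eqF.
have -> : B + 2 * T^-1 = (T * B + 2) / T by field; rewrite gt_eqF.
rewrite !expr_div_n (powN T).
set a := (T ^+ (p + q)) ^+ n.+1; set b := T ^+ 2; set g := T ^+ K.-1.
have a0 : 0 < a by rewrite !exprn_gt0.
have b0 : 0 < b by rewrite !exprn_gt0.
have g0 : 0 < g by rewrite !exprn_gt0.
set U := (T - _) ^+ N; set V := (T + 1) ^+ 2; set W := (_ + 2) ^+ _.
have cn0 : 0 < c ^+ n.+1 by rewrite exprn_gt0// ltr0n muln_gt0 !fact_gt0.
have fN0 : 0 < N`!%:R :> R by rewrite ltr0n fact_gt0.
have fK0 : 0 < K.-1`!%:R :> R by rewrite ltr0n fact_gt0.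
rewrite -(ler_pM2r (_ : 0 < (a * b * g)^-1)); last by rewrite invr_gt0 !mulr_gt0.
congr (_ <= _).
  by field; rewrite !gt_eqF.
by field; rewrite !gt_eqF.
Unshelve. all: by end_near.
Qed.

Lemma linear_extensions_ge (eps : R) : 0 <= eps <= 1 -> 2 * eps < B ->
  c ^- n.+1 * (eps ^+ (p + q) * (B - 2 * eps) ^+ K.+1 / K.+1`!%:R)
  <= e%:R / N`!%:R.
Proof.
move=> eps01 epsB.
pose F s : R := c ^- n.+1 * (eps ^+ (p + q)) / K.+1`!%:R
   * ((B - 2 * eps) + -3 * harmonic s) ^+ K.+1.
pose G s : R := e%:R / N`!%:R * (1 + 1 * harmonic s) ^+ N +
  ((1 + 1 * harmonic s) ^+ N - (1 + - N%:R * harmonic s) ^+ N).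
have cF : (F s @[s --> \oo] --> (c ^- n.+1 * (eps ^+ (p + q)) / K.+1`!%:R
   * (B - 2 * eps) ^+ K.+1 : R))%classic.
  by apply: cvgMl_tmp; exact: cvg_affine_harmonicX.
have cG : (G s @[s --> \oo] --> (e%:R / N`!%:R * 1 ^+ N + (1 ^+ N - 1 ^+ N) : R))%classic.
  apply: cvgD; first by apply: cvgMl_tmp; exact: cvg_affine_harmonicX.
  by apply: cvgB; exact: cvg_affine_harmonicX.
suff FG : (\forall s \near \oo, F s <= G s)%classic.
  have /(_ eventually_filter) := ler_cvg_to cF cG FG.
  rewrite !expr1n mulr1 subrr addr0; apply: le_trans.
  by rewrite le_eqVlt; apply/orP; left; apply/eqP; ring.
near=> s.
pose t := s.+1; pose T : R := t%:R.
have T0 : 0 < T by rewrite ltr0n.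
have tN : (N <= t)%N.
  by apply: leqW; near: s; exists N.
have pos : 0 <= (B - 2 * eps) + -3 * harmonic s.
  near: s; have := @cvg_affine_harmonicX (B - 2 * eps) (-3) 1.
  by move/cvgr_ge; apply; rewrite expr1 subr_gt0.
have := @linear_extensions_ge_discrete R p d q n t hab (ltn0Sn s) eps eps01.
have QE : T * B - 1 - 2 * (eps * T + 1) = T * ((B - 2 * eps) + -3 * T^-1).
  by field; rewrite gt_eqF.
cbv zeta; rewrite -/T QE (pmulr_rge0 _ T0) => /(_ pos).
have /andP[ff_ge ff_le] := ffact_bounds t N.
rewrite card_cluster_poset natrD [(e * _)%:R]natrM binE natrB// => le_disc.
have le2 : e%:R * ((t.+1 ^_ N)%:R / N`!%:R) + ((t.+1 ^ N)%:R - (t.+1 ^_ N)%:R)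
   <= e%:R * ((T + 1) ^+ N / N`!%:R) + ((T + 1) ^+ N - (T - N%:R) ^+ N).
  have T1E : T + 1 = t.+1%:R by rewrite natr1.
  apply: lerD.
    rewrite ler_wpM2l ?ler0n// ler_pM2r ?invr_gt0 ?ltr0n ?fact_gt0//.
    by rewrite T1E -natrX ler_nat.
  by rewrite T1E natrX lerD2l lerN2 /T -natrB// -natrX ler_nat.
have := le_trans le_disc le2.
rewrite /F /G /harmonic -/t -/T.
have -> : 1 + - N%:R * T^-1 = (T - N%:R) / T by field; rewrite gt_eqF.
have -> : 1 + 1 * T^-1 = (T + 1) / T by field; rewrite gt_eqF.
set Q := B - 2 * eps + -3 * T^-1.
have KE : T ^+ K.+1 = T ^+ 2 * T ^+ K.-1.
  by rewrite -exprD add2n prednK// muln_gt0 d0.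
rewrite [(T * Q) ^+ _]exprMn KE !expr_div_n (powN T).
set a := (T ^+ (p + q)) ^+ n.+1; set b := T ^+ 2; set g := T ^+ K.-1.
have a0 : 0 < a by rewrite !exprn_gt0.
have b0 : 0 < b by rewrite !exprn_gt0.
have g0 : 0 < g by rewrite !exprn_gt0.
set U := (T - _) ^+ N; set V := (T + 1) ^+ N; set W := Q ^+ _.
have cn0 : 0 < c ^+ n.+1 by rewrite exprn_gt0// ltr0n muln_gt0 !fact_gt0.
have fN0 : 0 < N`!%:R :> R by rewrite ltr0n fact_gt0.
have fK0 : 0 < K.+1`!%:R :> R by rewrite ltr0n fact_gt0.
rewrite -(ler_pM2r (_ : 0 < (a * b * g)^-1)); last by rewrite invr_gt0 !mulr_gt0.
congr (_ <= _).
  by field; rewrite !gt_eqF.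
by field; rewrite !gt_eqF.
Unshelve. all: by end_near.
Qed.
End ContinuumLimit.

(** * Gamma and Beta at integers *)

Section EulerIntegralValues.
Context (R : realType).

Lemma cvg_exprn_expRN k : ((x : R) ^+ k * expR (- x) @[x --> +oo] --> (0 : R))%classic.
Proof.
apply/cvgrPdist_le => eps eps0; near=> x.
have x0 : 0 < x by near: x; apply: nbhs_pinfty_gt; exact: num_real.
rewrite sub0r normrN ger0_norm; last by rewrite mulr_ge0 ?expR_ge0// exprn_ge0 ?ltW.
have xeps : k.+1`!%:R / eps <= x by near: x; apply: nbhs_pinfty_ge; exact: num_real.
rewrite expRN ler_pdivrMr ?expR_gt0//.
have le_exp : x ^+ k.+1 / k.+1`!%:R <= expR x.
  by apply: le_trans (expR_ge1Dxn k (ltW x0)); rewrite lerDr.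
apply: le_trans (ler_wpM2l (ltW eps0) le_exp).
rewrite exprSr [leRHS](_ : _ = x ^+ k * (x * eps / k.+1`!%:R)); last by ring.
rewrite ler_peMr ?exprn_ge0 ?(ltW x0)// ler_pdivlMr ?ltr0n ?fact_gt0// mul1r.
by rewrite -ler_pdivrMr.
Unshelve. all: by end_near.
Qed.

(** Integration by parts, carried out on primitives: this vanishes at infinity
    and takes the value - k! at 0. *)
Fixpoint gamma_primitive (k : nat) (x : R) : R :=
  if k is k'.+1 then
    - (x ^+ k * expR (- x)) + k%:R * gamma_primitive k' x
  else - expR (- x).

Lemma gamma_primitive0 k : gamma_primitive k 0 = - k`!%:R.
Proof.
elim: k => [|k IH] /=; first by rewrite oppr0 expR0.
by rewrite expr0n mul0r oppr0 add0r IH mulrN -natrM factS.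
Qed.

Lemma is_derive_gamma_primitive k (x : R) :
  is_derive x (1 : R) (gamma_primitive k) (x ^+ k * expR (- x)).
Proof.
have dexp : is_derive x (1 : R) (fun y : R => expR (- y)) (- expR (- x)).
  have d : is_derive x (1 : R) (expR \o -%R) (expR (- x) * -1) by apply: is_derive1_comp.
  by apply: is_derive_eq; rewrite mulrN1.
elim: k => [|k IH].
  by apply: is_derive_eq; rewrite opprK mul1r.
have dX : is_derive x (1 : R) (fun y : R => y ^+ k.+1) (k.+1%:R * x ^+ k).
  have -> : (fun y : R => y ^+ k.+1) = id ^+ k.+1 by rewrite exprfctE.
  apply: (is_derive_eq (is_deriveX k.+1 (is_derive_id x (1 : R)))).
  by rewrite /GRing.scale /= mulr1.
have dM := is_deriveN (is_deriveM dX dexp).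
apply: (is_derive_eq (is_deriveD dM (is_deriveZ k.+1%:R IH))).
rewrite /GRing.scale /=; ring.
Qed.

Lemma cvg_gamma_primitive k : (gamma_primitive k x @[x --> +oo] --> (0 : R))%classic.
Proof.
elim: k => [|k IH].
  have := @cvgr_expR R; move/cvgN; rewrite oppr0; exact.
suff : (gamma_primitive k.+1 x @[x --> +oo] --> (- 0 + k.+1%:R * 0 : R))%classic.
  by rewrite mulr0 oppr0 addr0.
apply: cvgD; first by apply: cvgN; exact: cvg_exprn_expRN.
by apply: cvgMl_tmp.
Qed.

Lemma continuous_gamma_integrand k : continuous (fun x : R => x ^+ k * expR (- x)).
Proof.
move=> x; apply: cvgM; first exact: exprn_continuous.
apply: (@cvg_comp _ _ _ (-%R : R -> R) (@expR R)); first exact: opp_continuous.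
exact: continuous_expR.
Qed.

Lemma Gamma_natE k : Gamma (k%:R + 1) = k`!%:R :> R.
Proof.
rewrite /Gamma addrK.
transitivity (\int[@lebesgue_measure R]_(x in `[0, +oo[) (x ^+ k * expR (- x))).
  rewrite /Rintegral; congr fine; rewrite -integral_itv_obnd_cbnd/=.
    apply: eq_integral => x; rewrite inE/= in_itv/= andbT => x0.
    by rewrite powR_mulrn// ltW.
  apply/measurable_EFinP; apply: measurable_funTS; apply: continuous_measurable_fun.
  exact: continuous_gamma_integrand.
have F0 := gamma_primitive0 k.
rewrite (@Rintegral_ge0_continuous_FTC2y _ _ (gamma_primitive k) _ 0).
- by rewrite F0 sub0r opprK.
- by move=> x x0; rewrite mulr_ge0 ?expR_ge0// exprn_ge0.
- exact/continuous_subspaceT/continuous_gamma_integrand.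
- exact: cvg_gamma_primitive.
- by move=> x _; case: (is_derive_gamma_primitive k x).
- apply: cvg_at_right_filter; apply: differentiable_continuous.
  by apply/derivable1_diffP; case: (is_derive_gamma_primitive k 0).
- move=> x _; rewrite derive1E; by case: (is_derive_gamma_primitive k x).
Qed.

Lemma Beta_natE p q : Beta (p%:R + 1) (q%:R + 1) = (p`! * q`!)%:R / (p + q).+1`!%:R :> R.
Proof.
rewrite -beta_fun_fact /Beta !addrK /beta_fun -Rintegral_mkcond.
apply: eq_Rintegral => x; rewrite inE/= in_itv/= => /andP[x0 x1].
by rewrite !powR_mulrn// subr_ge0.
Qed.
End EulerIntegralValues.

(** * Logarithmic asymptotics *)

Section Asymptotics.
Context (R : realType).

Lemma ln_nat_step k : (0 < k)%N ->
  k.+1%:R^-1 <= (ln k.+1%:R - ln k%:R : R) <= k%:R^-1.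
Proof.
move=> k0; have kR : 0 < k%:R :> R by rewrite ltr0n.
have k1R : 0 < k.+1%:R :> R by rewrite ltr0n.
rewrite -ln_div ?posrE//; apply/andP; split; last first.
  rewrite [X in ln X](_ : _ = 1 + k%:R^-1); last by rewrite -natr1; field; rewrite gt_eqF.
  by apply: le_ln1Dx; rewrite (lt_trans _ (_ : 0 < _)) ?invr_gt0// ltrN10.
rewrite -invf_div lnV ?posrE ?divr_gt0// lerNr.
rewrite [X in ln X](_ : _ = 1 - k.+1%:R^-1); last by rewrite -natr1; field; rewrite natr1 gt_eqF.
by apply: le_ln1Dx; rewrite ltrN2 invf_lt1// ltr1n.
Qed.

(** A crude Stirling formula; the error is allowed to be logarithmic. *)
Lemma ln_fact_bounds k : (0 < k)%N ->
  k%:R * ln k%:R - k%:R <= (ln k`!%:R : R) <= k%:R * ln k%:R - k%:R + ln k%:R + 1.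
Proof.
elim: k => // -[_ _|k IH _]; first by rewrite factS fact0 muln1 ln1; lra.
have /andP[lo hi] := IH isT; have /andP[s1 s2] := @ln_nat_step k.+1 isT.
rewrite factS natrM lnM ?posrE ?ltr0n ?fact_gt0//.
have k1R : 0 < k.+1%:R :> R by rewrite ltr0n.
have k2R : 0 < k.+2%:R :> R by rewrite ltr0n.
set x := ln k.+1%:R in lo hi s1 s2 *; set y := ln k.+2%:R in s1 s2 *.
have h2 : k.+1%:R * (y - x) <= 1 by rewrite mulrC -ler_pdivlMr// div1r.
have h1 : 1 <= k.+2%:R * (y - x) by rewrite mulrC -ler_pdivrMr// div1r.
move: lo hi h1 h2; rewrite -[k.+2%:R]natr1; set z := k.+1%:R; nra.
Qed.

Lemma Bernoulli_le (x : R) k : 0 <= x <= 1 -> 1 - k%:R * x <= (1 - x) ^+ k.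
Proof.
move=> /andP[x0 x1]; elim: k => [|k IH]; first by rewrite mul0r subr0 expr0.
have x10 : 0 <= 1 - x by rewrite subr_ge0.
rewrite exprS; apply: le_trans (ler_wpM2l x10 IH).
by rewrite -natr1; have : 0 <= k%:R :> R by []; set z := k%:R; nra.
Qed.

Context (p d q n : nat) (hab : (0 < p.+1 < (p + d).+1)%N).

Local Notation P := (cluster_poset (p + d + q).+1 p.+1 (p + d).+1 n.+1 hab).
Local Notation K := (n.+1 * d)%N.
Local Notation c := ((p`! * q`!)%:R : R).
Local Notation B := (Beta (p%:R / d%:R + 1) (q%:R / d%:R + 1) : R).
Local Notation e := (num_linear_extensions P).
Local Notation M := (p + d + q)%N.

Let d0 : (0 < d)%N. Proof. by move: hab; lia. Qed.
Let B0 : 0 < B. Proof. exact: Beta_gt0. Qed.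
Let B1 : B <= 1. Proof. exact: Beta_le1. Qed.
Let K0 : (0 < K)%N. Proof. by rewrite muln_gt0. Qed.
Let c0 : 0 < c. Proof. by rewrite ltr0n muln_gt0 !fact_gt0. Qed.
Let fact0R k : 0 < k`!%:R :> R. Proof. by rewrite ltr0n fact_gt0. Qed.

(* With this choice (B - 2 eps)^(K + 1) is at least B^(K + 1) / 2 by Bernoulli's
   inequality, while eps^(p + q) is only polynomially small in n. *)
Let eps : R := B / (4 * K.+1%:R).

Let lower : c ^- n.+1 * (eps ^+ (p + q) * (B ^+ K.+1 / 2) / K.+1`!%:R)
  <= e%:R / (n.+1 * M).+1`!%:R.
Proof.
have K4 : 1 <= 4 * K.+1%:R :> R by rewrite -natrM ler1n.
have K40 : 0 < 4 * K.+1%:R :> R by apply: lt_le_trans K4.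
have eps0 : 0 < eps by rewrite divr_gt0.
have eps01 : 0 <= eps <= 1.
  by rewrite ltW//= ler_pdivrMr// mul1r (le_trans B1).
have epsB : 2 * eps < B.
  rewrite /eps mulrA ltr_pdivrMr// mulrC ltr_pM2l//.
  by rewrite -natrM ltr_nat (@leq_trans 4)// leq_pmulr.
apply: le_trans (@linear_extensions_ge R p d q n hab eps eps01 epsB).
rewrite ler_pM2l ?invr_gt0 ?exprn_gt0// ler_pM2r ?invr_gt0// ler_pM2l ?exprn_gt0//.
have k0 : K.+1%:R != 0 :> R by rewrite pnatr_eq0.
have xE : B - 2 * eps = B * (1 - (2 * K.+1%:R)^-1).
  by rewrite /eps; move: K.+1%:R k0 => k k0; field.
rewrite xE exprMn ler_pM2l ?exprn_gt0//.
apply: le_trans (Bernoulli_le K.+1 _); last first.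
  by rewrite invr_ge0 invf_le1 -?natrM ?ler1n ?ltr0n ?ler0n.
by rewrite le_eqVlt; apply/orP; left; apply/eqP; move: K.+1%:R k0 => k k0; field.
Qed.

Let e0 : 0 < e%:R :> R.
Proof.
have : 0 < e%:R / (n.+1 * M).+1`!%:R :> R.
  apply: lt_le_trans lower.
  by rewrite !(mulr_gt0, divr_gt0, exprn_gt0, invr_gt0).
by rewrite pmulr_lgt0 ?invr_gt0.
Qed.

(** With n rows, every factor that is polynomial in n in the two bounds has a
    logarithm at most ln (8 M) + ln n, where M = m - 1; the right-hand side
    collects these, and the boundary factors of B. *)
Lemma ln_linear_extensions_approx :
  `|ln e%:R - ((M%:R - d%:R) * n.+1%:R * ln n.+1%:R
     + (d%:R * ln B - ln c + M%:R * ln M%:R - d%:R * ln d%:R - M%:R + d%:R) * n.+1%:R)|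
  <= (p + q + 3)%:R * (ln (8 * M)%:R + ln n.+1%:R) + (p + q + 1)%:R * (- ln B) + 1.
Proof.
have M0 : (0 < M)%N by lia.
have lnB : ln B <= 0 by exact: ln_le0.
have nM0 : (0 < n.+1 * M)%N by rewrite muln_gt0.
set X := ln (8 * M)%:R + ln n.+1%:R.
have ln_bound k : (0 < k <= 8 * (n.+1 * M))%N -> ln k%:R <= X.
  move=> /andP[k0 kle]; have M8 : (0 < 8 * M)%N by rewrite muln_gt0.
  rewrite /X -lnM ?posrE ?ltr0n// -natrM ler_ln ?posrE ?ltr0n ?muln_gt0 ?M0//.
  by rewrite ler_nat -mulnA [(M * _)%N]mulnC.
have K_le : (K <= n.+1 * M)%N by rewrite leq_mul2l; lia.
have up : ln e%:R <= ln (n.+1 * M).+1`!%:R - n.+1%:R * ln c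
    + K.-1%:R * ln B - ln K.-1`!%:R.
  have := @linear_extensions_le R p d q n hab.
  rewrite -(ler_ln (x := e%:R / _)) ?posrE; last 2 first.
  - by rewrite divr_gt0.
  - by rewrite !(mulr_gt0, divr_gt0, exprn_gt0, invr_gt0).
  rewrite ln_div ?posrE// lnM ?posrE ?invr_gt0 ?divr_gt0 ?exprn_gt0//.
  rewrite lnV ?posrE ?exprn_gt0// ln_div ?posrE ?exprn_gt0// !lnXn//.
  rewrite -[ln c *+ _]mulr_natl -[ln B *+ _]mulr_natl; lra.
have lo : ln (n.+1 * M).+1`!%:R - n.+1%:R * ln c + (p + q)%:R * (ln B - ln (4 * K.+1)%:R)
    + K.+1%:R * ln B - ln 2 - ln K.+1`!%:R <= ln e%:R.
  have eps0 : 0 < eps by rewrite divr_gt0// mulr_gt0.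
  have := lower.
  rewrite -ler_ln ?posrE; last 2 first.
  - by rewrite !(mulr_gt0, divr_gt0, exprn_gt0, invr_gt0).
  - by rewrite divr_gt0.
  rewrite [ln (_ / (n.+1 * M).+1`!%:R)]ln_div ?posrE//.
  have BK0 : 0 < B ^+ K.+1 by rewrite exprn_gt0.
  have Y0 : 0 < eps ^+ (p + q) by rewrite exprn_gt0.
  have Z0 : 0 < B ^+ K.+1 / 2 by rewrite divr_gt0 ?exprn_gt0.
  have C0 : 0 < c ^- n.+1 by rewrite invr_gt0 exprn_gt0.
  rewrite [ln (c ^- _ * _)]lnM ?posrE ?divr_gt0 ?mulr_gt0//.
  rewrite lnV ?posrE ?exprn_gt0// [ln (_ * _ / _)]ln_div ?posrE ?mulr_gt0//.
  rewrite [ln (_ * (_ / 2))]lnM ?posrE// [ln (_ / 2)]ln_div ?posrE ?exprn_gt0//.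
  rewrite !lnXn// /eps ln_div ?posrE ?mulr_gt0// -natrM.
  rewrite -[ln c *+ _]mulr_natl -[ln B *+ _]mulr_natl -[(_ - _) *+ _]mulr_natl; lra.
have /andP[N1 N2] := @ln_fact_bounds (n.+1 * M) nM0.
have /andP[K1 K2] := @ln_fact_bounds K K0.
have NE : ln (n.+1 * M).+1`!%:R = ln (n.+1 * M).+1%:R + ln (n.+1 * M)`!%:R :> R.
  by rewrite factS natrM lnM ?posrE ?ltr0n ?fact_gt0.
have KE : ln K.+1`!%:R = ln K.+1%:R + ln K`!%:R :> R.
  by rewrite factS natrM lnM ?posrE ?ltr0n ?fact_gt0.
have KPE : ln K.-1`!%:R = ln K`!%:R - ln K%:R :> R.
  rewrite -[in ln K`!%:R](prednK K0) factS prednK// natrM.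
  by rewrite lnM ?posrE ?ltr0n ?fact_gt0// addrAC subrr add0r.
have lnnM : ln (n.+1 * M)%:R = ln n.+1%:R + ln M%:R :> R.
  by rewrite natrM lnM ?posrE ?ltr0n.
have lnnd : ln K%:R = ln n.+1%:R + ln d%:R :> R.
  by rewrite natrM lnM ?posrE ?ltr0n.
have [b1 b2 b3] : [/\ (0 < n.+1 * M <= 8 * (n.+1 * M))%N,
    (n.+1 * M).+1 <= 8 * (n.+1 * M) & 0 < K <= 8 * (n.+1 * M)]%N.
  by move: K0 nM0 K_le; move: (n.+1 * M)%N K => x y; clear => *; split; lia.
have [b4 b5 b6] : [/\ K.+1 <= 8 * (n.+1 * M),
    4 * K.+1 <= 8 * (n.+1 * M) & 2 <= 8 * (n.+1 * M)]%N.
  by move: K0 nM0 K_le; move: (n.+1 * M)%N K => x y; clear => *; split; lia.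
have x1 : ln (n.+1 * M)%:R <= X by exact: ln_bound.
have x2 : ln (n.+1 * M).+1%:R <= X by exact: ln_bound.
have x3 : ln K%:R <= X by exact: ln_bound.
have x4 : ln K.+1%:R <= X by exact: ln_bound.
have x5 : ln (4 * K.+1)%:R <= X by exact: ln_bound.
have x6 : ln 2 <= X by exact: (ln_bound 2%N).
have x7 : 0 <= ln (n.+1 * M).+1%:R :> R by rewrite ln_ge0// ler1n.
have x8 : (p + q)%:R * ln (4 * K.+1)%:R <= (p + q)%:R * X :> R by rewrite ler_wpM2l.
have K1R : K.+1%:R * ln B = K%:R * ln B + ln B by rewrite -natr1 mulrDl mul1r.
have KPR : K.-1%:R * ln B = K%:R * ln B - ln B.
  by rewrite -[in RHS](prednK K0) -natr1 mulrDl mul1r addrK.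
have X0 : 0 <= X by apply: le_trans x6; rewrite ln_ge0// ler1n.
have pqX : 0 <= (p + q)%:R * X by rewrite mulr_ge0.
have pqB : 0 <= (p + q)%:R * - ln B by rewrite mulr_ge0// oppr_ge0.
(* The logarithms of M and d in the constant come from ln (n M) and ln (n d). *)

have -> : (M%:R - d%:R) * n.+1%:R * ln n.+1%:R
     + (d%:R * ln B - ln c + M%:R * ln M%:R - d%:R * ln d%:R - M%:R + d%:R) * n.+1%:R
   = ((n.+1 * M)%:R * ln (n.+1 * M)%:R - (n.+1 * M)%:R)
     - (K%:R * ln K%:R - K%:R) + K%:R * ln B - n.+1%:R * ln c :> R.
  by rewrite lnnM lnnd [(n.+1 * M)%:R]natrM [K%:R]natrM; ring.
have -> : (p + q + 3)%:R * X = (p + q)%:R * X + 3 * X by rewrite natrD mulrDl.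
have -> : (p + q + 1)%:R * - ln B = (p + q)%:R * - ln B - ln B.
  by rewrite natrD mulrDl mul1r.
rewrite NE K1R KE mulrBr in lo; rewrite NE KPR KPE in up; rewrite mulrN in pqB *.
move: up lo N1 N2 K1 K2 x1 x2 x3 x4 x5 x6 x7 x8 X0 pqX pqB lnB.
clear; set A := _ * ln (n.+1 * M)%:R - _; set D := _ * ln K%:R - _.
move: A D; move: (ln e%:R) (ln (n.+1 * M)`!%:R) (ln K`!%:R) (ln (n.+1 * M).+1%:R).
move: (ln (n.+1 * M)%:R) (ln K%:R) (ln K.+1%:R) (K%:R * ln B) (n.+1%:R * ln c).
move: ((p + q)%:R * ln B) ((p + q)%:R * X) ((p + q)%:R * ln (4 * K.+1)%:R).
move: (ln B) (ln (4 * K.+1)%:R) (ln 2) X => *.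
by rewrite ler_norml; apply/andP; split; lra.
Qed.

End Asymptotics.

(** The Beta and Gamma values at integers collapse to p! q!. *)
Lemma cluster_constE (R : realType) (p d q : nat) : (0 < d)%N ->
  cluster_const R (p + d + q).+1 p.+1 (p + d).+1
  = d%:R * ln (Beta (p%:R / d%:R + 1) (q%:R / d%:R + 1)) - ln (p`! * q`!)%:R
    + (p + d + q)%:R * ln (p + d + q)%:R - d%:R * ln d%:R - (p + d + q)%:R + d%:R.
Proof.
move=> d0; rewrite /cluster_const.
have -> : (p + d).+1%:R - p.+1%:R = d%:R :> R by rewrite -!natr1 natrD; ring.
have -> : (p + d + q).+1%:R - (p + d).+1%:R = q%:R :> R by rewrite -!natr1 !natrD; ring.
have -> : p.+1%:R - 1 = p%:R :> R by rewrite -natr1 addrK.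
have -> : (p + d + q).+1%:R - 1 = (p + d + q)%:R :> R by rewrite -natr1 addrK.
have -> : q%:R + p.+1%:R + 1 = (p + q).+1%:R + 1 :> R by rewrite -!natr1 natrD; ring.
rewrite -natr1 Beta_natE Gamma_natE ln_div ?posrE ?ltr0n ?muln_gt0 ?fact_gt0//.
by rewrite -!natr1 !natrD; ring.
Qed.

Local Open Scope classical_set_scope.

Theorem theorem1p4 (R : realType) (m a b : nat)
    (hab : (1 <= a < b)%N) (hbm : (b <= m)%N) :
  (fun n : nat => ln (num_linear_extensions (cluster_poset m a b n hab))%:R : R)
  = (fun n : nat => (m%:R - b%:R + a%:R - 1) * n%:R * ln n%:R
                    + cluster_const R m a b * n%:R)
    +O_\oo (fun n : nat => ln n%:R : R).
Proof.
have [p aE] : exists p, a = p.+1 by exists a.-1; lia.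
have [d bE] : exists d, b = (p + d).+1 by exists (b - a)%N; lia.
have [q mE] : exists q, m = (p + d + q).+1 by exists (m - b)%N; lia.
subst a b m; have d0 : (0 < d)%N by lia.
set B : R := Beta (p%:R / d%:R + 1) (q%:R / d%:R + 1).
pose L : R := ln (8 * (p + d + q))%:R.
pose c1 : R := (p + q + 3)%:R.
pose c2 : R := c1 * L + (p + q + 1)%:R * (- ln B) + 1.
have ln2 : 0 < ln 2 :> R by rewrite ln_gt0// ltr1n.
have c2_ge0 : 0 <= c2.
  have L0 : 0 <= L by rewrite ln_ge0// ler1n; lia.
  have B0 : ln B <= 0 by apply: ln_le0; exact: Beta_le1.
  by rewrite /c2 !addr_ge0// mulr_ge0// oppr_ge0.
have coefE : (p + d + q).+1%:R - (p + d).+1%:R + p.+1%:R - 1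
    = (p + d + q)%:R - d%:R :> R by rewrite -!natr1 !natrD; ring.
rewrite coefE; apply/eqaddOP; near=> k; near=> n.
have n2 : (2 <= n)%N by near: n; exists 2%N.
have ln_n : ln 2 <= ln n%:R :> R by rewrite ler_ln ?posrE ?ltr0n ?ler_nat// (ltn_trans _ n2).
have := @ln_linear_extensions_approx R p d q n.-1 hab.
rewrite prednK; last exact: ltn_trans n2.
rewrite -/B -/L -/c1 -(cluster_constE R p q d0) => approx.
apply: le_trans approx _.
rewrite ger0_norm; last exact: le_trans (ltW ln2) ln_n.
apply: (@le_trans _ _ ((c1 + c2 / ln 2) * ln n%:R)); last first.
  by rewrite ler_wpM2r ?(le_trans (ltW ln2))//; near: k; apply: nbhs_pinfty_ge; exact: num_real.
have : c2 <= c2 / ln 2 * ln n%:R by rewrite mulrAC ler_pdivlMr// ler_wpM2l.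
by rewrite /c2; lra.
Unshelve. all: by end_near.
Qed.
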